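(* Let $r, s \ge 2$ be distinct integers. No real number can have simultaneously a Sturmian $r$-ary expansion and a Sturmian $s$-ary expansion.
   Context: For an integer $b \ge 2$ and a real number $\xi$, write $\xi = \lfloor \xi \rfloor + \sum_{k \ge 1} a_k b^{-k}$, where each $a_k \in \{0, 1, \ldots, b-1\}$ and infinitely many $a_k$ are not equal to $b-1$. The sequence $(a_k)_{k\ge 1}$ is uniquely determined; it is called the $b$-ary expansion of $\xi$ and is viewed as the infinite word $a_1 a_2 \ldots$ over $\{0, 1, \ldots, b-1\}$. For an infinite word $\mathbf x = x_1 x_2 \ldots$ over a finite alphabet and a positive integer $n$, $p(n, \mathbf x) := \mathrm{Card}\{x_{j+1} \ldots x_{j+n} : j \ge 0\}$. An infinite word $\mathbf x$ is Sturmian if $p(n, \mathbf x) = n + 1$ for all $n \ge 1$. *)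

(* Defs.v *)
From HB Require Import structures.
From mathcomp Require Import all_boot all_order all_algebra.
From mathcomp Require Import all_classical all_reals all_analysis.

Set Implicit Arguments.
Unset Strict Implicit.
Unset Printing Implicit Defensive.

Import Order.TTheory GRing.Theory Num.Theory.
Import numFieldNormedType.Exports.
Local Open Scope classical_set_scope.
Local Open Scope ring_scope.

(* An infinite word x_1 x_2 ... is indexed from 0: x k is the letter x_{k+1}. *)
Definition word (T : Type) := nat -> T.

(* The factor x_{j+1} ... x_{j+n}. *)
Definition factor (T : Type) (x : word T) (j n : nat) : n.-tuple T :=
  [tuple x (j + i)%N | i < n].

Definition complexity (T : finType) (n : nat) (x : word T) : nat :=
  #|[pred w : n.-tuple T | `[< exists j : nat, w = factor x j n >]]|.

Definition sturmian (T : finType) (x : word T) : Prop :=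
  forall n : nat, (1 <= n)%N -> complexity n x = n.+1.

(* With the shifted indexing, the digit a k has weight b^-(k+1). *)
Definition is_expansion (R : realType) (b : nat) (xi : R) (a : word 'I_b) :
    Prop :=
  ((Num.floor xi)%:~R + series (fun k => (a k)%:R / b%:R ^+ k.+1) n : R)
    @[n --> \oo] --> xi /\
  infinite_set [set k | (a k : nat) <> b.-1].

Definition has_sturmian_expansion (R : realType) (b : nat) (xi : R) : Prop :=
  exists a : word 'I_b, is_expansion xi a /\ sturmian a.

(* Main.v *)
Require Import Defs.
From HB Require Import structures.
From mathcomp Require Import all_boot all_order all_algebra.
From mathcomp Require Import all_classical all_reals all_analysis.
From mathcomp Require Import cyclic zify ring lra.
Import Defs.

(** Let x be the word of xi in base r and y its word in base s, both Sturmian.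

    Combinatorics. Look at the first repetition of a window of length n in a
    Sturmian word. As n grows, the pair of positions of the two equal windows stays
    constant on plateaus, and at the end of a plateau at level n the new repetition
    starts at position n+2 ([plateau_next]); this comes from the uniqueness of the
    branching factor of each length ([branching_unique]). Two consecutive plateaus
    have coprime periods ([plateau_periods_coprime]), and plateaus can be
    arbitrarily long ([long_plateau]).

    If r = t^a and s = t^b with a, b coprime, everything is read in base t. Copies
    of a prefix of y found anywhere in base t must respect the cutting into digits
    of base s ([prefix_synchronized]), so that b divides the periods of two
    consecutive plateaus of x; hence b = 1, by symmetry a = 1, and r = s
    ([common_base_exponent]).

    Otherwise r and s are multiplicatively independent. A repetition at i < j gives
    an approximation P/Q of xi with Q = r^i (r^(j-i) - 1) and an error governed by
    the end of its plateau. On a long plateau, comparison with an approximation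
    coming from y shows that both fractions are equal, and comparison with the next
    plateau shows that they are in lowest terms up to bounded factors. This gives
    infinitely many solutions of g' r^i (r^d - 1) = g s^i' (s^d' - 1) with bounded
    g, g' ([common_approximation]).

    Such an equation has only finitely many solutions ([sunit_equation]).
    Comparison of p-adic valuations bounds i and i' logarithmically, so that
    g' r^(i+d) and g s^(i'+d') are very close. After splitting the exponents modulo
    8 these are values A X^8 and B Y^8 with finitely many pairs (A, B), as in the
    theorem of Thue. One solution X0, Y0 makes A X0^8 / (B Y0^8) so close to 1 that
    the diagonal Pade approximants of the function w^(1/8) at this point form a
    dense sequence of very good approximations of (A/B)^(1/8), which leave no
    room for the approximation Y1/X1 given by a much larger solution
    ([thue_core], [thue_gap]). The remainder of the Pade approximation is bounded
    from both sides by its integral representation ([pade_remainder]), so a single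
    approximant suffices. *)

Set Implicit Arguments.
Unset Strict Implicit.
Unset Printing Implicit Defensive.

(** * Factors and aperiodicity *)

Lemma factor_eqP (T : finType) (x : word T) (u v n : nat) :
  factor x u n = factor x v n <-> forall i, i < n -> x (u + i) = x (v + i).
Proof.
split=> [e i lt_in | e].
  by have := congr1 (fun w => tnth w (Ordinal lt_in)) e; rewrite !tnth_mktuple.
by apply: eq_from_tnth => i; rewrite !tnth_mktuple; apply: e.
Qed.

Definition factors (T : finType) (x : word T) (n : nat) : {set n.-tuple T} :=
  [set w | `[< exists j, w = factor x j n >]].

Lemma card_factors (T : finType) (x : word T) (n : nat) :
  #|factors x n| = complexity n x.
Proof. by rewrite /complexity; apply: eq_card => w; rewrite inE. Qed.

Lemma factor_in (T : finType) (x : word T) (u n : nat) :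
  factor x u n \in factors x n.
Proof. by rewrite inE; apply/asboolP; exists u. Qed.

Lemma factorsP (T : finType) (x : word T) (n : nat) (w : n.-tuple T) :
  w \in factors x n -> exists u, w = factor x u n.
Proof. by rewrite inE => /asboolP. Qed.

Lemma complexity0 (T : finType) (x : word T) : complexity 0 x = 1.
Proof.
rewrite -card_factors; apply/eqP/cards1P; exists (factor x 0 0).
by apply/setP => w; rewrite inE (tuple0 w) (tuple0 (factor x 0 0)) eqxx inE;
  apply/asboolP; exists 0; rewrite [RHS]tuple0.
Qed.

Lemma factor_trunc (T : finType) (x : word T) (u v n n' : nat) : n' <= n ->
  factor x u n = factor x v n -> factor x u n' = factor x v n'.
Proof.
by move=> le /factor_eqP e; apply/factor_eqP => i lt; apply: e; lia.
Qed.

Lemma factorS (T : finType) (x : word T) (u v n : nat) :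
  factor x u n.+1 = factor x v n.+1 <->
  factor x u n = factor x v n /\ x (u + n) = x (v + n).
Proof.
split=> [/factor_eqP e|[/factor_eqP e1 e2]].
  by split; [apply/factor_eqP => i lt|]; apply: e; lia.
apply/factor_eqP => i lt; have [->//|ne] := eqVneq i n; apply: e1; lia.
Qed.

Lemma factor_behead (T : finType) (x : word T) (u v n : nat) :
  factor x u n.+1 = factor x v n.+1 -> factor x u.+1 n = factor x v.+1 n.
Proof.
move=> /factor_eqP e; apply/factor_eqP => i lt.
by rewrite !addSnnS; apply: e; lia.
Qed.

Definition eventually_periodic (T : Type) (x : word T) : Prop :=
  exists D N, 0 < D /\ forall k, N <= k -> x (k + D) = x k.

Lemma repeated_factor (T : finType) (x : word T) (n h : nat) (p : nat -> nat) :
  complexity n x < h ->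
  exists u v, [/\ u < v, v < h & factor x (p u) n = factor x (p v) n].
Proof.
move=> lt; apply: contrapT => no.
have: #|[set factor x (p i) n | i : 'I_h]| = h.
  rewrite card_imset ?card_ord// => i j e; apply/val_inj/eqP => /=.
  case: ltngtP => // c; case: no; [exists i, j | exists j, i]; split=> //;
    by case: i j e c => ? ? [].
suff: #|[set factor x (p i) n | i : 'I_h]| <= complexity n x by lia.
rewrite -card_factors; apply/subset_leq_card/fintype.subsetP => w /imsetP[i _ ->].
exact: factor_in.
Qed.

Lemma complexity_le (T : finType) (x : word T) (n h : nat) (p : nat -> nat) :
  (forall u, exists2 i, i < h & factor x u n = factor x (p i) n) ->
  complexity n x <= h.
Proof.
move=> cov; rewrite -card_factors.
have: #|[set factor x (p i) n | i : 'I_h]| <= h.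
  by rewrite (leq_trans (leq_imset_card _ _)) ?card_ord.
apply: leq_trans; apply/subset_leq_card/fintype.subsetP => w /factorsP[u ->].
have [i lt ->] := cov u.
by apply/imsetP; exists (Ordinal lt).
Qed.

Lemma deterministic_periodic (T : finType) (x : word T) (n N : nat) :
  (forall u v, N <= u -> N <= v -> factor x u n = factor x v n ->
     x (u + n) = x (v + n)) ->
  eventually_periodic x.
Proof.
move=> det.
have [u [v [lt _ e]]] := @repeated_factor T x n _ (fun i => N + i) (ltnSn _).
have ek k : factor x (N + u + k) n = factor x (N + v + k) n.
  elim: k => [|k IH]; first by rewrite !addn0.
  rewrite !addnS; apply: factor_behead; apply/factorS; split=> //.
  by apply: det => //; lia.
exists (v - u), (N + u + n); split=> [|k le]; first lia.
have -> : k + (v - u) = N + v + (k - (N + u + n)) + n by lia.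
have {2}-> : k = N + u + (k - (N + u + n)) + n by lia.
by apply/esym/det => //; lia.
Qed.

(** The complexity is 1 at level 0, so it does not increase at some level below n;
    there every factor has only one right extension. *)
Lemma morse_hedlund (T : finType) (x : word T) (n : nat) :
  complexity n x <= n -> eventually_periodic x.
Proof.
elim: n => [|n IH]; first by rewrite complexity0.
move=> le; have [|lt] := leqP (complexity n x) n; first exact: IH.
pose g (w : n.+1.-tuple T) : n.-tuple T := [tuple tnth w (widen_ord (leqnSn n) i) | i < n].
have gE u : g (factor x u n.+1) = factor x u n.
  by apply: eq_from_tnth => i; rewrite !tnth_mktuple.
have gI : g @: factors x n.+1 = factors x n.
  apply/setP => w; apply/imsetP/idP => [[w' /factorsP[u ->] ->]|/factorsP[u ->]].
    by rewrite gE factor_in.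
  by exists (factor x u n.+1); rewrite ?factor_in ?gE.
have inj : {in factors x n.+1 &, injective g}.
  apply/imset_injP; rewrite gI !card_factors; apply/eqP.
  have := leq_imset_card g (factors x n.+1); rewrite gI !card_factors; lia.
apply: (@deterministic_periodic _ x n 0) => u v _ _ e.
have : factor x u n.+1 = factor x v n.+1.
  by apply: inj; rewrite ?factor_in// !gE.
by move/factorS => [].
Qed.

Lemma sturmianE (T : finType) (x : word T) : sturmian x ->
  forall n, complexity n x = n.+1.
Proof. by move=> st [|n]; [apply: complexity0 | apply: st]. Qed.

Lemma sturmian_aperiodic (T : finType) (x : word T) :
  sturmian x -> ~ eventually_periodic x.
Proof.
move=> st [D [N [D0 per]]].
have perM q k : N <= k -> x (k + q * D) = x k.
  elim: q => [|q IH] le; first by rewrite mul0n addn0.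
  by rewrite mulSn addnCA addnC per ?IH//; lia.
have : complexity (N + D) x <= N + D.
  apply: (@complexity_le _ _ _ _ id) => u.
  exists (if u < N then u else N + (u - N) %% D).
    by case: ifP => lt; [lia | have := ltn_pmod (u - N) D0; lia].
  apply/factor_eqP => i _; case: ifP => // /negbT; rewrite -leqNgt => le.
  have -> : u + i = N + (u - N) %% D + i + (u - N) %/ D * D.
    by have := divn_eq (u - N) D; lia.
  by apply: perM; lia.
by rewrite sturmianE// ltnn.
Qed.

(** Since a Sturmian word has exactly one factor more in length n+1 than in
    length n, exactly one pair of factors of length n+1 has a common prefix of
    length n; hence two branchings at level n are the same pair. *)
Lemma branching_unique (T : finType) (x : word T) (n a b c d : nat) :
  sturmian x ->
  factor x a n = factor x b n -> x (a + n) <> x (b + n) ->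
  factor x c n = factor x d n -> x (c + n) <> x (d + n) ->
  (factor x c n.+1 = factor x a n.+1 /\ factor x d n.+1 = factor x b n.+1) \/
  (factor x c n.+1 = factor x b n.+1 /\ factor x d n.+1 = factor x a n.+1).
Proof.
move=> st eab nab ecd ncd.
pose g (w : n.+1.-tuple T) : n.-tuple T :=
  [tuple tnth w (widen_ord (leqnSn n) i) | i < n].
have gE u : g (factor x u n.+1) = factor x u n.
  by apply: eq_from_tnth => i; rewrite !tnth_mktuple.
have main p q : factor x p n = factor x q n -> x (p + n) <> x (q + n) ->
    {in factors x n.+1 :\ factor x p n.+1 &, injective g}.
  move=> epq npq; apply/imset_injP.
  have card1 : #|factors x n.+1 :\ factor x p n.+1| = n.+1.
    have := cardsD1 (factor x p n.+1) (factors x n.+1).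
    by rewrite factor_in card_factors sturmianE// => -[].
  rewrite eqn_leq leq_imset_card card1 /=.
  have cn : #|factors x n| = n.+1 by rewrite card_factors sturmianE.
  apply: leq_trans (eq_leq (esym cn)) _.
  apply/subset_leq_card/fintype.subsetP => w /factorsP[u ->].
  apply/imsetP; have [e|ne] := eqVneq (factor x u n.+1) (factor x p n.+1).
    exists (factor x q n.+1); last by rewrite gE -epq -!gE e.
    rewrite !inE; apply/andP; split; last by have := factor_in x q n.+1; rewrite inE.
    by apply/eqP => /factorS[_ /esym].
  exists (factor x u n.+1); last by rewrite gE.
  by rewrite !inE ne; have := factor_in x u n.+1; rewrite inE.
have mem p q : factor x p n = factor x q n -> x (p + n) <> x (q + n) ->
    factor x c n.+1 = factor x p n.+1 \/ factor x d n.+1 = factor x p n.+1.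
  move=> epq npq; apply: contrapT => no.
  have : factor x c n.+1 = factor x d n.+1.
    apply: (main p q) => //; rewrite ?gE// in_setD1 factor_in andbT.
      by apply/eqP => e; apply: no; left.
    by apply/eqP => e; apply: no; right.
  by move/factorS => [_ /ncd].
have := mem a b eab nab; have := mem b a (esym eab) (nesym nab).
have nab' : factor x a n.+1 <> factor x b n.+1 by move/factorS => [_ /nab].
move=> [] e [] e'.
- by case: nab'; rewrite -e -e'.
- by right.
- by left.
- by case: nab'; rewrite -e -e'.
Qed.

Lemma branching_exists (T : finType) (x : word T) (n : nat) : sturmian x ->
  exists a b, factor x a n = factor x b n /\ x (a + n) <> x (b + n).
Proof.
move=> st; apply: contrapT => no; apply: (sturmian_aperiodic st).
apply: (@deterministic_periodic _ x n 0) => u v _ _ e.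
by apply: contrapT => ne; apply: no; exists u, v.
Qed.

Definition shift (T : Type) (m : nat) (x : word T) : word T :=
  fun k => x (m + k).

Lemma factor_shift (T : finType) (x : word T) (m u n : nat) :
  factor (shift m x) u n = factor x (m + u) n.
Proof.
by apply: eq_from_tnth => i; rewrite !tnth_mktuple /shift addnA.
Qed.

Lemma shift_complexity (T : finType) (x : word T) (m n : nat) :
  sturmian x -> n < complexity n (shift m x).
Proof.
move=> st; rewrite ltnNge; apply/negP => /morse_hedlund[D [N [D0 per]]].
apply: (sturmian_aperiodic st); exists D, (m + N); split=> // k le.
have -> : k = m + (k - m) by lia.
by rewrite -addnA; apply: (per (k - m)); lia.
Qed.

(** * Plateaus of the first repetition *)

(** A plateau records how the first repetition of a window of length l evolves
    with l: for every l in [m, n] the first window of length l that has occurred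
    before starts at m+1 and its earlier copy starts at i, while the two copies
    are followed by different letters at l = n. *)
Definition plateau (T : finType) (x : word T) (m i n : nat) : Prop :=
  [/\ i <= m <= n,
      forall u v, u < v -> v <= m -> factor x u m <> factor x v m,
      factor x i n = factor x m.+1 n & x (i + n) <> x (m.+1 + n)].

Lemma plateau_injective (T : finType) (x : word T) (m i n l u v : nat) :
  plateau x m i n -> m <= l -> u <= m -> v <= m ->
  factor x u l = factor x v l -> u = v.
Proof.
case=> _ inj _ _ le um vm e; apply/eqP; case: ltngtP => // c.
- by case: (inj u v c vm); apply: factor_trunc e.
- by case: (inj v u c um); apply/esym; apply: factor_trunc e.
Qed.

Lemma first_repetition (T : finType) (x : word T) (n : nat) : sturmian x ->
  exists i j, [/\ i < j, j <= n.+1, factor x i n = factor x j n &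
    forall u v, u < v -> v < j -> factor x u n <> factor x v n].
Proof.
move=> st.
have ex : exists j, `[< exists2 i, i < j & factor x i n = factor x j n >].
  have [|u [v [lt _ e]]] := @repeated_factor T x n n.+2 id.
    by rewrite sturmianE.
  by exists v; apply/asboolP; exists u.
case: (ex_minnP ex) => j /asboolP[i lt e] mn; exists i, j.
have dist u v : u < v -> v < j -> factor x u n <> factor x v n.
  move=> uv vj e'; have := mn v; rewrite leqNgt vj => /(_ _)/negP; case=> //.
  by apply/asboolP; exists u.
split=> //; rewrite leqNgt; apply/negP => gt.
have [|u [v [uv vn e']]] := @repeated_factor T x n n.+2 id.
  by rewrite sturmianE.
by apply: (dist u v) => //; lia.
Qed.

Lemma break_exists (T : finType) (x : word T) (i j n : nat) : sturmian x ->
  i < j -> factor x i n = factor x j n ->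
  exists n', [/\ n <= n', factor x i n' = factor x j n' & x (i + n') <> x (j + n')].
Proof.
move=> st lt e.
have ex : exists k, x (i + k) != x (j + k).
  apply: contrapT => no; apply: (sturmian_aperiodic st).
  exists (j - i), i; split=> [|k le]; first lia.
  apply/eqP/negPn/negP => ne; apply: no; exists (k - i).
  have -> : i + (k - i) = k by lia.
  have -> : j + (k - i) = k + (j - i) by lia.
  by rewrite eq_sym.
case: (ex_minnP ex) => n' ne mn; exists n'; split; last exact/eqP.
- rewrite leqNgt; apply/negP => gt; move/factor_eqP: e => /(_ n' gt) e.
  by rewrite e eqxx in ne.
- apply/factor_eqP => k lt'; apply/eqP/negPn/negP => /mn; lia.
Qed.

Lemma plateau0 (T : finType) (x : word T) : sturmian x ->
  exists n, plateau x 0 0 n.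
Proof.
move=> st.
have e : factor x 0 0 = factor x 1 0 by apply/factor_eqP.
have [n [_ en ne]] := break_exists st (ltnSn 0) e.
by exists n; split=> // u v; lia.
Qed.

(** Once the earlier and the later copy are followed by different letters, the
    unique branching of level n has been seen completely, so the set of windows
    of length n+1 met before their first repetition is closed under successor;
    hence it contains all n+2 factors of length n+1. *)
Lemma plateau_next (T : finType) (x : word T) (m i n : nat) : sturmian x ->
  plateau x m i n -> exists i' n', plateau x n.+1 i' n'.
Proof.
move=> st pl; have [/andP[im mn] inj en nen] := pl.
have [i' [j' [lt' j'n e' inj']]] := first_repetition n.+1 st.
have dist u v : u < v -> v <= m.+1 -> factor x u n.+1 <> factor x v n.+1.
  move=> uv; rewrite leq_eqVlt => /orP[/eqP ve | vm] /factorS[e ex].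
    rewrite ve in uv e ex.
    have ui : u = i.
      by apply: (plateau_injective pl mn) => //; rewrite e -en.
    by rewrite ui in ex.
  have : u = v by apply: (plateau_injective pl mn) => //; lia.
  lia.
have jj' : m.+1 < j'.
  by rewrite ltnNge; apply/negP => le; case: (dist i' j').
have clo u : exists2 p, p < j' & factor x u n.+1 = factor x p n.+1.
  elim: u => [|u [p pj IH]]; first by exists 0 => //; lia.
  have [->|ne] := eqVneq (factor x u.+1 n.+1) (factor x p.+1 n.+1).
    have [e|pne] := eqVneq p.+1 j'; first by exists i' => //; rewrite e -e'.
    by exists p.+1 => //; lia.
  have eu := factor_behead IH.
  have nu : x (u.+1 + n) <> x (p.+1 + n).
    by move=> e; move/eqP: ne; apply; apply/factorS.
  have [[-> _]|[-> _]] := branching_unique st en nen eu nu.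
    by exists i => //; lia.
  by exists m.+1 => //; lia.
have j'E : j' = n.+2.
  apply/eqP; rewrite eqn_leq j'n -(sturmianE st n.+1).
  exact: (@complexity_le _ _ _ _ id).
rewrite {}j'E in lt' e' inj' {jj' clo j'n}.
have [n' [le' en' ne']] := break_exists st lt' e'.
by exists i', n'; split=> //; lia.
Qed.

(** The walk on windows of length n+1 between two consecutive plateaus: it either
    follows the initial segment of the word (closed up by the repetition of the
    second plateau), or takes the other exit of the branching of level n. *)
Lemma plateau_step (T : finType) (x : word T) (m i n i' n' u p : nat) :
  sturmian x -> plateau x m i n -> plateau x n.+1 i' n' -> p <= n.+1 ->
  factor x u n.+1 = factor x p n.+1 ->
  let q := if p == n.+1 then i' else p.+1 in
  [\/ factor x u.+1 n.+1 = factor x q n.+1,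
      q = i /\ factor x u.+1 n.+1 = factor x m.+1 n.+1 |
      q = m.+1 /\ factor x u.+1 n.+1 = factor x i n.+1].
Proof.
move=> st pl pl' pn e q.
have [/andP[im mn] _ en nen] := pl.
have [/andP[i'n n'n] _ en' _] := pl'.
have qn : q <= n.+1 by rewrite /q; case: ifP; lia.
have epq : factor x p.+1 n.+1 = factor x q n.+1.
  by rewrite /q; case: ifP => // /eqP->; apply/esym; apply: factor_trunc en'.
have [->|ne] := eqVneq (factor x u.+1 n.+1) (factor x p.+1 n.+1).
  by constructor 1.
have eu := factor_behead e.
have nu : x (u.+1 + n) <> x (p.+1 + n).
  by move=> ex; move/eqP: ne; apply; apply/factorS.
have := branching_unique st en nen eu nu; rewrite epq.
move=> -[] [eu1 eq1]; [constructor 3 | constructor 2]; split=> //;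
  by apply: (plateau_injective pl' (leqnn _)) => //; lia.
Qed.

(** If i and i' were both positive, the first window of length n+1 would never come
    back, and deleting the first letter would leave a word with at most n+1
    factors of this length. *)
Lemma plateau_zero (T : finType) (x : word T) (m i n i' n' : nat) :
  sturmian x -> plateau x m i n -> plateau x n.+1 i' n' -> i = 0 \/ i' = 0.
Proof.
move=> st pl pl'; apply: contrapT => /not_orP[i0 i'0].
have [/andP[im mn] _ _ _] := pl; have [/andP[i'n n'n] _ _ _] := pl'.
have clo u : exists2 p, 0 < p <= n.+1 & factor x u.+1 n.+1 = factor x p n.+1.
  elim: u => [|u [p /andP[p0 pn] IH]]; first by exists 1.
  have := plateau_step st pl pl' pn IH.
  case=> [->|[_ ->]|[_ ->]]; [|by exists m.+1 => //; lia|by exists i => //; lia].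
  by exists (if p == n.+1 then i' else p.+1) => //; case: ifP; lia.
have := @shift_complexity _ _ 1 n.+1 st; rewrite ltnNge => /negP; apply.
apply: (@complexity_le _ _ _ _ id) => u; have [p pn e] := clo u.
by exists p.-1; [lia | rewrite !factor_shift !add1n prednK//; lia].
Qed.

(** If i' > m+1, the walk on windows would be trapped in the cycle from i' to n+2,
    which avoids the branching, and the word would be eventually periodic. *)
Lemma plateau_start_le (T : finType) (x : word T) (m i n i' n' : nat) :
  sturmian x -> plateau x m i n -> plateau x n.+1 i' n' -> i' <= m.+1.
Proof.
move=> st pl pl'; rewrite leqNgt; apply/negP => gt.
have [/andP[im mn] _ _ _] := pl; have [/andP[i'n n'n] _ _ _] := pl'.
have clo k : exists2 p, i' <= p <= n.+1 & factor x (i' + k) n.+1 = factor x p n.+1.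
  elim: k => [|k [p /andP[ip pn] IH]]; first by exists i'; rewrite ?addn0//; lia.
  have := plateau_step st pl pl' pn IH; rewrite -addnS.
  case=> [->|[]|[]]; [|by case: ifP; lia|by case: ifP; lia].
  by exists (if p == n.+1 then i' else p.+1) => //; case: ifP; lia.
apply: (sturmian_aperiodic st).
apply: (@deterministic_periodic _ x n.+1 i') => u v iu iv e.
suff: factor x u.+1 n.+1 = factor x v.+1 n.+1.
  by case/factorS => _; rewrite !addSnnS.
have [p /andP[ip pn]] := clo (u - i'); rewrite subnKC// => eu.
have ev : factor x v n.+1 = factor x p n.+1 by rewrite -e.
have := plateau_step st pl pl' pn eu; have := plateau_step st pl pl' pn ev.
have : i' <= (if p == n.+1 then i' else p.+1) by case: ifP; lia.
move: (if _ then _ else _) => q iq; case=> [->|[]|[]]; [|lia|lia].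
by case=> [->|[]|[]] //; lia.
Qed.

(** A phase modulo b is a class attached to the windows of some length which
    increases by one along the word. At the level of the second plateau it exists
    as soon as b divides the two return times; the branching word of level l+1,
    which has a well-defined phase, ends with the branching word of level l, so a
    phase at level l+1 descends to level l, and at level 0 it forces b = 1. *)
Lemma plateau_periods_coprime (T : finType) (x : word T) (m i n i' n' b : nat) :
  sturmian x -> plateau x m i n -> plateau x n.+1 i' n' ->
  m.+1 = i %[mod b] -> n.+2 = i' %[mod b] -> b = 1.
Proof.
move=> st pl pl' b1 b2.
pose phase l := forall u v, factor x u l = factor x v l -> u = v %[mod b].
have [/andP[im mn] _ _ _] := pl; have [/andP[i'n n'n] _ _ _] := pl'.
have qE p : (if p == n.+1 then i' else p.+1) = p.+1 %[mod b].
  by case: ifP => // /eqP->.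
have clo u : exists p, [/\ p <= n.+1, factor x u n.+1 = factor x p n.+1 &
    u = p %[mod b]].
  elim: u => [|u [p [pn IH up]]]; first by exists 0.
  have up1 : u.+1 = p.+1 %[mod b] by rewrite -addn1 -modnDml up modnDml addn1.
  have := plateau_step st pl pl' pn IH.
  case=> [->|[q ->]|[q ->]]; last 2 first.
  - by exists m.+1; split=> //; rewrite b1 -q qE.
  - exists i; split=> //; last by rewrite -b1 -q qE.
    exact: leq_trans im (leq_trans mn (leqnSn n)).
  exists (if p == n.+1 then i' else p.+1); rewrite qE; split=> //.
  by case: ifP => // c; rewrite ltn_neqAle c.
have top : phase n.+1.
  move=> u v e; have [p [pn ep ->]] := clo u; have [q [qn eq ->]] := clo v.
  by congr (_ %% _); apply: (plateau_injective pl' (leqnn _)) => //;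
    rewrite -ep -eq.
have down l : phase l.+1 -> phase l.
  move=> ph u v e; have [ex|nex] := eqVneq (x (u + l)) (x (v + l)).
    by apply: ph; apply/factorS.
  have [a [c [eac nac]]] := branching_exists l.+1 st.
  have ac : a.+1 = c.+1 %[mod b].
    by rewrite -addn1 -modnDml (ph _ _ eac) modnDml addn1.
  have eac' := factor_behead eac; rewrite -!addSnnS in nac.
  have := branching_unique st eac' nac e (elimN eqP nex).
  by case=> -[/ph-> /ph->]; rewrite ac.
have ph0 : phase 0 by elim: n.+1 top => // l IH /down/IH.
have : 0 = 1 %[mod b] by apply: ph0; apply/factor_eqP.
by case: b {b1 b2 phase qE clo top down ph0} => [|[|b]] //.
Qed.

Lemma plateau_prefix (T : finType) (x : word T) (N : nat) : sturmian x ->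
  exists m n, N <= m /\ plateau x m 0 n.
Proof.
move=> st.
have [m [i [n [Nm pl]]]] : exists m i n, N <= m /\ plateau x m i n.
  elim: N => [|N [m [i [n [Nm pl]]]]].
    by have [n pl] := plateau0 st; exists 0, 0, n.
  have [i' [n' pl']] := plateau_next st pl; exists n.+1, i', n'; split=> //.
  by case: pl => /andP[]; lia.
have [i' [n' pl']] := plateau_next st pl.
have [i0|i0] := plateau_zero st pl pl'.
  by exists m, n; rewrite -i0.
exists n.+1, n'; rewrite -i0; split=> //.
by case: pl => /andP[]; lia.
Qed.

(** Prefix repetitions (i = 0) occur on at least one of two consecutive plateaus. If
    all plateaus past some point were short, consecutive prefix repetitions would
    occur at bounded distance D, giving arbitrarily long prefixes of period D for
    some fixed D, hence a periodic word. *)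
Lemma long_plateau (T : finType) (x : word T) (C N : nat) : sturmian x ->
  exists m i n, [/\ N <= m, m + C <= n & plateau x m i n].
Proof.
move=> st; apply: contrapT => no.
have short m i n : N <= m -> plateau x m i n -> n < m + C.
  move=> Nm pl; rewrite ltnNge; apply/negP => le; apply: no.
  by exists m, i, n.
have /choice[f fP] D : exists k, 0 < D -> x (k + D) <> x k.
  apply: contrapT => none; apply: (sturmian_aperiodic st).
  have [D0|/negP nD] := boolP (0 < D); last by case: none; exists 0.
  exists D, 0; split=> // k _; apply: contrapT => nk; apply: none.
  by exists k.
pose K := \max_(D < C.*2.+1) f D.
have fK D : D <= C.*2 -> f D <= K.
  by move=> le; exact: (@leq_bigmax _ (fun D : 'I_C.*2.+1 => f D) (Ordinal (le : D < C.*2.+1))).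
have [m [n [mN pl]]] := plateau_prefix (N + K + C.*2).+1 st.
have [/andP[_ mn] _ en _] := pl.
have sh := short m 0 n _ pl.
have [i1 [n1 pl1]] := plateau_next st pl.
have [m2 [n2 [lt le pl2]]] : exists m2 n2, [/\ m < m2, m2 <= m + C.*2 & plateau x m2 0 n2].
  have [i10|i10] := eqVneq i1 0.
    by exists n.+1, n1; rewrite -i10; split=> //; lia.
  have [i2 [n2 pl2]] := plateau_next st pl1.
  have [|i20] := plateau_zero st pl1 pl2; first by move/eqP: i10.
  have [/andP[_ m1] _ _ _] := pl1; have sh1 := short _ _ _ _ pl1.
  by exists n1.+1, n2; rewrite -i20; split=> //; lia.
have [/andP[_ mn2] _ en2 _] := pl2.
have D0 : 0 < m2 - m by lia.
have DC : f (m2 - m) <= K by apply: fK; lia.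
apply: (fP _ D0); move/factor_eqP: en => en; move/factor_eqP: en2 => en2.
rewrite -[f _ + _]add0n en; last lia.
rewrite -[X in _ = x X]add0n en2; last lia.
by congr x; lia.
Qed.

(** * Two bases that are powers of a common base *)

Lemma sturmian_two_letters (T : finType) (x : word T) : sturmian x ->
  exists A B, A <> B /\ forall k, x k = A \/ x k = B.
Proof.
move=> st; have [a [b [eab nab]]] := branching_exists 0 st.
exists (x a), (x b); rewrite -[a]addn0 -[b]addn0; split=> // k.
apply: contrapT => /not_orP[na nb].
have e0 u v : factor x u 0 = factor x v 0 by apply/factor_eqP.
have := branching_unique st eab nab (e0 k a); rewrite addn0 => /(_ na).
by case=> -[/factorS[_]]; rewrite addn0.
Qed.

Lemma letter_change (T : finType) (x : word T) (u : nat) : sturmian x ->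
  exists2 v, u <= v & x v = x u /\ x v.+1 <> x u.
Proof.
move=> st; apply: contrapT => no.
have cst k : x (u + k) = x u.
  elim: k => [|k IH]; first by rewrite addn0.
  by apply: contrapT => ne; apply: no; exists (u + k); rewrite ?leq_addr// -addnS.
apply: (sturmian_aperiodic st); exists 1, u; split=> // k le.
have -> : k = u + (k - u) by lia.
by rewrite -addnA !cst.
Qed.

Lemma factor1 (T : finType) (x : word T) (u v : nat) :
  x u = x v -> factor x u 1 = factor x v 1.
Proof. by move=> e; apply/factor_eqP => -[]// _; rewrite !addn0. Qed.

(** A Sturmian word has only one branching letter, so it cannot contain the
    squares of two different letters. *)
Lemma sturmian_square (T : finType) (x : word T) (u v : nat) : sturmian x ->
  x u = x u.+1 -> x v = x v.+1 -> x u = x v.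
Proof.
move=> st eu ev; have [a _ [ea na]] := letter_change u st.
have [c _ [ec nc]] := letter_change v st.
have := @branching_unique _ x 1 u a v c st (factor1 (esym ea)) _ (factor1 (esym ec)).
rewrite !addn1 -eu -ev => /(_ (nesym na) (nesym nc)).
by case=> -[/factor_eqP/(_ 0 isT)]; rewrite !addn0 ?ea.
Qed.

Lemma sturmian_pairs (T : finType) (x : word T) : sturmian x ->
  exists L M, [/\ L <> M, forall k, x k = L \/ x k = M,
    exists k, x k = L /\ x k.+1 = L,
    exists k, x k = L /\ x k.+1 = M &
    exists k, x k = M /\ x k.+1 = L].
Proof.
move=> st; have [A [B [AB lett]]] := sturmian_two_letters st.
have [a [c [/factor_eqP/(_ 0 isT) e n]]] := branching_exists 1 st.
rewrite !addn0 !addn1 in e n.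
have [L [M [LM lett' aL]]] : exists L M,
    [/\ L <> M, forall k, x k = L \/ x k = M & x a = L].
  have [xa|xa] := lett a; first by exists A, B.
  by exists B, A; split=> // [/esym//|k]; case: (lett k); [right | left].
have [k1 [k2 [h1 h2 h3 h4]]] : exists k1 k2,
    [/\ x k1 = L, x k1.+1 = L, x k2 = L & x k2.+1 = M].
  rewrite aL in e; have [a1|a1] := lett' a.+1; have [c1|c1] := lett' c.+1.
  - by case: n; rewrite a1.
  - by exists a, c.
  - by exists c, a.
  - by case: n; rewrite a1.
exists L, M; split=> //; first by exists k1.
  by exists k2.
have [v _ [ev nv]] := letter_change k2.+1 st; exists v; rewrite ev h4; split=> //.
by case: (lett' v.+1) => // vM; rewrite vM h4 in nv.
Qed.

(** The t-adic window of length l at u, when T m is the integer part of t^m xi. *)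
Definition window (t : nat) (T : nat -> nat) (u l : nat) : nat :=
  T (u + l) %% t ^ l.

Definition expands (t : nat) (T : nat -> nat) : Prop :=
  0 < t /\ forall m, T m = T m.+1 %/ t.

Lemma expandsD (t : nat) (T : nat -> nat) (m l : nat) :
  expands t T -> T m = T (m + l) %/ t ^ l.
Proof.
case=> t0 e; elim: l => [|l IH]; first by rewrite addn0 expn0 divn1.
by rewrite IH addnS (e (m + l)) -divnMA expnS.
Qed.

Lemma windowD (t : nat) (T : nat -> nat) (u k l : nat) : expands t T ->
  window t T u (k + l) = window t T u k * t ^ l + window t T (u + k) l.
Proof.
move=> ex; rewrite /window (expandsD (u + k) l ex) addnA expnD.
have tl : 0 < t ^ l by rewrite expn_gt0; case: ex => ->.
move: (T _) (t ^ k) (t ^ l) tl => X p q q0.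
have [->|p0] := posnP p; first by rewrite !mul0n !modn0 -divn_eq.
rewrite {1}(divn_eq X q) {1}(divn_eq (X %/ q) p) mulnDl -mulnA -addnA modnMDl.
rewrite modn_small//; have := ltn_pmod (X %/ q) p0; have := ltn_pmod X q0; nia.
Qed.

Lemma window_ltn (t : nat) (T : nat -> nat) (u l : nat) : expands t T ->
  window t T u l < t ^ l.
Proof. by case=> t0 _; rewrite ltn_pmod// expn_gt0 t0. Qed.

Lemma window_divn (t : nat) (T : nat -> nat) (u k l : nat) : expands t T ->
  window t T u k = window t T u (k + l) %/ t ^ l.
Proof.
move=> ex; have := window_ltn (u + k) l ex => lt.
by rewrite windowD// divnMDl ?divn_small ?addn0//; lia.
Qed.

Lemma window_modn (t : nat) (T : nat -> nat) (u k l : nat) : expands t T ->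
  window t T (u + k) l = window t T u (k + l) %% t ^ l.
Proof.
move=> ex; have := window_ltn (u + k) l ex => lt.
by rewrite windowD// modnMDl modn_small.
Qed.

Lemma sub_window (t : nat) (T : nat -> nat) (u v c l n : nat) : expands t T ->
  c + l <= n -> window t T u n = window t T v n ->
  window t T (u + c) l = window t T (v + c) l.
Proof.
move=> ex le e; rewrite !window_modn// !(window_divn _ (c + l) (n - (c + l)) ex).
by rewrite subnKC// e.
Qed.

Lemma digit_pair (f a b c d : nat) : c < f -> d < f ->
  a * f + c = b * f + d -> a = b /\ c = d.
Proof.
move=> cf df e; have f0 : 0 < f by lia.
split.
  by have := congr1 (fun k => k %/ f) e; rewrite !divnMDl// !divn_small ?addn0.
by have := congr1 (fun k => k %% f) e; rewrite !modnMDl !modn_small.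
Qed.

(** Two digits L <> M, cut into heads and tails and reassembled across the cuts,
    do not give back only L and M: the three junctions LL, LM, ML have three
    different values unless L and M have a common head or a common tail, and then
    the differences of the values and of the digits have different sizes. *)
Lemma misaligned_digits (e f L M : nat) : 1 < e -> 1 < f -> L <> M ->
  L < f * e -> M < f * e ->
  let F X Y := X %% e * f + Y %/ e in
  F L L = L \/ F L L = M -> F L M = L \/ F L M = M -> F M L = L \/ F M L = M ->
  False.
Proof.
move=> e1 f1 LM Lf Mf F; rewrite /F.
have e0 : 0 < e by lia.
have := ltn_pmod L e0; have := ltn_pmod M e0.
have : L %/ e < f by rewrite ltn_divLR.
have : M %/ e < f by rewrite ltn_divLR.
have EL := divn_eq L e; have EM := divn_eq M e.
move: (L %/ e) (M %/ e) (L %% e) (M %% e) EL EM => pL pM sL sM EL EM.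
move=> pMf pLf sMe sLe.
have [pp|pp] := eqVneq pL pM; last first.
  have [ss|ss] := eqVneq sL sM.
    subst sM => h1 h2 _.
    have k1 : sL * f + pL <> sL * f + pM by lia.
    case: h1 h2 => [h1|h1] [h2|h2]; nia.
  move=> h1 h2 h3.
  have k1 : sL * f + pL <> sL * f + pM by lia.
  have k2 : sL * f + pL <> sM * f + pL by nia.
  have k3 : sL * f + pM <> sM * f + pL.
    by move/(digit_pair pMf pLf) => -[]; lia.
  lia.
subst pM => h1 _ h3.
have k : sL <> sM by move=> ss; apply: LM; rewrite EL EM ss.
case: h1 h3 => [h1|h1] [h3|h3]; nia.
Qed.

(** If a prefix containing all the junctions of a two-digit word in base t^b comes
    back at a position q in base t, then q is a multiple of b: otherwise the
    digits met after q would be junctions of the digits of the prefix. *)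
Lemma prefix_synchronized (t b K L M k1 k2 k3 q : nat) (T : nat -> nat) :
  1 < t -> 0 < b -> expands t T -> L <> M ->
  let z k := window t T (b * k) b in
  (forall k, z k = L \/ z k = M) ->
  k1 < K -> z k1 = L /\ z k1.+1 = L ->
  k2 < K -> z k2 = L /\ z k2.+1 = M ->
  k3 < K -> z k3 = M /\ z k3.+1 = L ->
  window t T 0 (b * K.+1) = window t T q (b * K.+1) -> b %| q.
Proof.
move=> t1 b0 ex LM z lett lt1 [zk1 zk1'] lt2 [zk2 zk2'] lt3 [zk3 zk3'] e.
apply/negPn/negP => nd.
have c0 : 0 < q %% b by rewrite lt0n.
have cb := ltn_pmod q b0; have qE := divn_eq q b.
move: (q %% b) (q %/ b) c0 cb qE => c d c0 cb qE.
have junction k : k < K ->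
    z (d + k).+1 = z k %% t ^ c * t ^ (b - c) + z k.+1 %/ t ^ c.
  move=> kK; rewrite {1}/z.
  have -> : b * (d + k).+1 = q + (b * k + (b - c)) by nia.
  rewrite -(sub_window ex _ e); last by nia.
  have := windowD (0 + (b * k + (b - c))) c (b - c) ex.
  rewrite subnKC 1?ltnW// => ->; rewrite /z; congr (_ * _ + _).
    by have := window_modn (b * k) (b - c) c ex; rewrite subnK 1?ltnW.
  have := window_divn (b * k.+1) (b - c) c ex; rewrite subnK 1?ltnW// => <-.
  by congr window; nia.
have tb : t ^ (b - c) * t ^ c = t ^ b by rewrite -expnD subnK 1?ltnW.
have zt k : z k < t ^ (b - c) * t ^ c by rewrite tb; apply: window_ltn.
apply: (@misaligned_digits (t ^ c) (t ^ (b - c)) L M) => //.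
- by rewrite -(exp1n c) ltn_exp2r.
- by rewrite -(exp1n (b - c)) ltn_exp2r//; lia.
- by rewrite -zk1; apply: zt.
- by rewrite -zk3; apply: zt.
- by have := junction _ lt1; rewrite zk1 zk1' => <-; apply: lett.
- by have := junction _ lt2; rewrite zk2 zk2' => <-; apply: lett.
- by have := junction _ lt3; rewrite zk3 zk3' => <-; apply: lett.
Qed.

Lemma factor_window (t a r : nat) (T : nat -> nat) (x : word 'I_r) (u v n : nat) :
  expands t T -> (forall k, x k = window t T (a * k) a :> nat) ->
  factor x u n = factor x v n ->
  window t T (a * u) (a * n) = window t T (a * v) (a * n).
Proof.
move=> ex xE; elim: n => [|n IH]; first by rewrite muln0 /window expn0 !modn1.
move=> /factorS[/IH e ex']; rewrite mulnSr !windowD// e -!mulnDr -!xE.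
by rewrite ex'.
Qed.

(** Repetitions in the word of base t^a happen at distances which are multiples
    of a in base t, and also of b by synchronization with the word of base t^b.
    As two consecutive periods are coprime, this leaves only b = 1. *)
Lemma common_base_exponent (t a b r s : nat) (T : nat -> nat)
    (x : word 'I_r) (z : word 'I_s) :
  1 < t -> 0 < a -> 0 < b -> coprime a b -> expands t T ->
  (forall k, x k = window t T (a * k) a :> nat) ->
  (forall k, z k = window t T (b * k) b :> nat) ->
  sturmian x -> sturmian z -> b = 1.
Proof.
move=> t1 a0 b0 ab ex xE zE sx sz.
have [L [M [LM lett [k1 [p1 q1]] [k2 [p2 q2]] [k3 [p3 q3]]]]] := sturmian_pairs sz.
pose K := (k1 + k2 + k3).+1; pose l := b * K.+1.
have sync q : window t T 0 l = window t T q l -> b %| q.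
  apply: (@prefix_synchronized _ _ _ L M k1 k2 k3) => //; 
    rewrite -?zE ?p1 ?q1 ?p2 ?q2 ?p3 ?q3 //; try by rewrite /K; lia.
  - by move/val_inj.
  - by move=> k; rewrite -zE; case: (lett k) => ->; [left | right].
have bl : 0 < l by rewrite /l muln_gt0 b0.
have prefix m n : l <= n -> plateau x m 0 n ->
    window t T 0 l = window t T (a * m.+1) l /\ b %| a * m.+1.
  move=> ln [_ _ en _]; have := factor_window ex xE en; rewrite muln0 => e.
  have e' : window t T 0 l = window t T (a * m.+1) l.
    have le : 0 + l <= a * n by nia.
    by have := sub_window ex le e; rewrite !addn0.
  by split=> //; apply: sync.
have [m0 [n0 [lm0 pl0]]] := plateau_prefix l sx.
have ln0 : l <= n0 by case: pl0 => /andP[_]; lia.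
have [e0 d0] := prefix _ _ ln0 pl0.
have [m [n [lm pl]]] := plateau_prefix (a * m0.+1 + l) sx.
have [/andP[_ mn] _ en _] := pl.
have ln : l <= n by lia.
have [e1 d1] := prefix _ _ ln pl.
have [i' [n' pl']] := plateau_next sx pl.
have [/andP[i'n n'n] _ en' _] := pl'.
have im := plateau_start_le sx pl pl'.
(* The repeated window of the second plateau must contain a copy of the prefix at
   a multiple q of b: the copy given by the first plateau if the window starts far
   enough from the origin, otherwise a fixed copy chosen beforehand. *)
have [q [iq qn dq eq]] : exists q, [/\ a * i' <= q, q + l <= a * i' + a * n',
    b %| q & window t T 0 l = window t T q l].
  have [li|li] := leqP l i'.
    by exists (a * m.+1); split=> //; nia.
  by exists (a * m0.+1); split=> //; nia.
have e2 := factor_window ex xE en'.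
have d2 : b %| q + a * n.+2 - a * i'.
  apply: sync; rewrite eq.
  have le : q - a * i' + l <= a * n' by lia.
  have := sub_window ex le e2; rewrite subnKC// => ->.
  by congr window; lia.
have coe p : b %| a * p -> b %| p by rewrite Gauss_dvdr// coprime_sym.
have h1 : m.+1 = 0 %[mod b] by rewrite mod0n; apply/eqP/coe.
have h2 : n.+2 = i' %[mod b].
  apply/eqP; rewrite eqn_mod_dvd; last lia.
  apply: coe; rewrite mulnBr.
  rewrite -addnBA ?dvdn_addr// in d2.
  by rewrite leq_mul2l (leq_trans i'n) ?orbT.
exact: (plateau_periods_coprime sx pl pl' h1 h2).
Qed.

(** * Integer coefficients for the Pade approximation of the eighth root *)

Lemma fact_odd_part (i : nat) : exists k q, [/\ k <= i, odd q & i`! = 2 ^ k * q].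
Proof.
elim/ltn_ind: i => i IH.
have [->|i0] := posnP i; first by exists 0, 1.
have fact_double k : exists2 q, odd q & k.*2`! = 2 ^ k * k`! * q.
  elim: k => [|k [q qo e]]; first by exists 1.
  exists (q * k.*2.+1); first by rewrite oddM qo /= odd_double.
  by rewrite doubleS !factS e expnS -!mul2n; nia.
have [k [q [ki qo e]]] := IH i./2 ltac:(lia).
have [q' qo' e'] := fact_double i./2.
have h : i./2.*2`! = 2 ^ (i./2 + k) * (q * q').
  by rewrite e' e expnD; ring.
have := odd_double_half i; case: (odd i) => /= ei; last first.
  by exists (i./2 + k), (q * q'); rewrite oddM qo qo' -h; split=> //; [lia|rewrite -{1}ei].
exists (i./2 + k), (i./2.*2.+1 * (q * q')); split; first lia.
  by rewrite !oddM qo qo' /= odd_double.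
by rewrite -{1}ei add1n factS h mulnCA.
Qed.

(** The generalized binomial coefficients of 1/8 are integers after multiplying
    by powers of two: the odd part of i! sees 8 as a unit, so modulo this odd part
    the progression is a multiple of a product of i consecutive integers. *)
Lemma fact_dvd_progression (i c : nat) :
  i`! %| 16 ^ i * \prod_(h < i) (8 * h + c).
Proof.
have [k [q [ki qo e]]] := fact_odd_part i; rewrite e.
rewrite (_ : 16 = 2 * 8)// expnMn -mulnA dvdn_mul ?dvdn_exp2l// dvdn_mull//.
have co8 : coprime 8 q by rewrite (coprimeXl 3 (_ : coprime 2 q))// coprime2n.
have q0 : 0 < q by case: q qo {e co8}.
pose u := 8 ^ (totient q).-1.
have u1 : 8 * u = 1 %[mod q].
  by rewrite -expnS prednK ?totient_gt0// Euler_exp_totient.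
have -> : (q %| \prod_(h < i) (8 * h + c)) = (q %| \prod_(h < i) (8 * (h + u * c))).
  rewrite /dvdn; congr (_ == _).
  elim/big_ind2: _ => // [x1 x2 y1 y2 ex ey|h _].
    by rewrite -modnMml -modnMmr ex ey modnMml modnMmr.
  by rewrite mulnDr mulnA -[in RHS]modnDmr -[in RHS]modnMml u1 modnMml mul1n modnDmr.
rewrite big_split /= dvdn_mull//.
have -> : \prod_(h < i) (h + u * c) = (i + u * c).-1 ^_ i.
  rewrite ffact_prod [RHS](reindex_inj rev_ord_inj) /=.
  by apply: eq_bigr => h _; have := ltn_ord h; lia.
by rewrite -bin_ffact e mulnCA dvdn_mull// dvdn_mull.
Qed.

(** The Pade numerators and denominators of (1+z)^(1/8) of degree N have
    coefficients U V / (i! (N-i)!), up to powers of two, where U and V are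
    progressions of difference 8. *)
Definition progU (N i : nat) := \prod_(h < i) (8 * h + (8 * (N - i) + 7)).
Definition progV (N i : nat) := \prod_(h < N - i) (8 * h + (8 * i + 9)).
Definition pade_coef (N i : nat) : nat :=
  (16 ^ i * progU N i) %/ i`! * ((16 ^ (N - i) * progV N i) %/ (N - i)`!).

Lemma pade_coefE (N i : nat) : i <= N ->
  pade_coef N i * (i`! * (N - i)`!) = 16 ^ N * (progU N i * progV N i).
Proof.
move=> iN; rewrite /pade_coef mulnACA !divnK ?fact_dvd_progression//.
by rewrite mulnACA -expnD subnKC.
Qed.

Lemma prod_fact (k m : nat) : \prod_(h < k) (h + m.+1) * m`! = (k + m)`!.
Proof.
elim: k => [|k IH]; first by rewrite big_ord0 mul1n.
by rewrite big_ord_recr /= mulnAC IH addSn factS; lia.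
Qed.

Lemma prod_leq (k : nat) (f g : nat -> nat) : (forall h, f h <= g h) ->
  \prod_(h < k) f h <= \prod_(h < k) g h.
Proof. by move=> le; elim/big_ind2: _ => // *; apply: leq_mul. Qed.

Lemma prod_leq_exp (k b : nat) (f g : nat -> nat) :
  (forall h, f h <= b * g h) ->
  \prod_(h < k) f h <= b ^ k * \prod_(h < k) g h.
Proof.
move=> le; elim: k => [|k IH]; first by rewrite !big_ord0.
by rewrite !big_ord_recr expnSr /= mulnACA leq_mul.
Qed.

Lemma bin_le_exp2 (N i : nat) : 'C(N, i) <= 2 ^ N.
Proof.
have [iN|/bin_small->//] := leqP i N.
rewrite (_ : 2 = 1 + 1)// expnDn (bigD1 (Ordinal (iN : i < N.+1))) //=.
by rewrite !exp1n !muln1 leq_addr.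
Qed.

Lemma pade_coef_le (N i : nat) : i <= N -> pade_coef N i <= 576 ^ N.
Proof.
move=> iN; pose F := i`! * (N - i)`!.
have F0 : 0 < F by rewrite muln_gt0 !fact_gt0.
have hU : progU N i * (N - i)`! <= 9 ^ i * N`!.
  rewrite -{3}(subnKC iN) -prod_fact mulnA leq_mul2r; apply/orP; right.
  by apply: (@prod_leq_exp _ _ (fun h => 8 * h + (8 * (N - i) + 7))
    (fun h => h + (N - i).+1)) => h; lia.
have hV : progV N i * i`! <= 9 ^ (N - i) * N`!.
  rewrite -{3}(subnK iN) -prod_fact mulnA leq_mul2r; apply/orP; right.
  by apply: (@prod_leq_exp _ _ (fun h => 8 * h + (8 * i + 9)) (fun h => h + i.+1)) => h; lia.
have FF : 0 < F * F by rewrite muln_gt0 F0.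
rewrite -(leq_pmul2r FF) mulnA pade_coefE//.
have le := leq_mul hU hV.
apply: (@leq_trans (16 ^ N * (9 ^ i * N`! * (9 ^ (N - i) * N`!)))).
  by rewrite -mulnA leq_pmul2l ?expn_gt0// /F (mulnC i`!) mulnACA.
have e : N`! = 'C(N, i) * F by rewrite bin_fact.
rewrite mulnACA -expnD subnKC// e.
set c := 'C(N, i); rewrite (_ : _ * (_ * _) = 16 ^ N * 9 ^ N * (c * c) * (F * F)).
  rewrite leq_pmul2r// (_ : 576 = 16 * 9 * (2 * 2))// !expnMn.
  by apply: leq_mul => //; apply: leq_mul; apply: bin_le_exp2.
by ring.
Qed.

Definition progP (k : nat) := \prod_(h < k) (8 * h + 1).
Definition progM (k : nat) := \prod_(h < k) (8 * h + 7).

Lemma progP_cat (N i : nat) : i <= N -> progP N.+1 = progP i.+1 * progV N i.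
Proof.
move=> /subnKC <-; rewrite /progP /progV addKn -addSn big_split_ord /=.
by congr (_ * _); apply: eq_bigr => h _ /=; lia.
Qed.

Lemma progM_cat (N i : nat) : i <= N -> progM N = progM (N - i) * progU N i.
Proof.
move=> /subnK <-; rewrite /progM /progU addnK big_split_ord /=; congr (_ * _).
by apply: eq_bigr => h _ /=; lia.
Qed.

Lemma progMP_bounds (N : nat) :
  (N`!) ^ 2 <= progM N * progP N.+1 <= 81 ^ N * (N`!) ^ 2.
Proof.
have hf : \prod_(h < N) (h + 1) = N`!.
  by have := prod_fact N 0; rewrite muln1 addn0.
have e : progP N.+1 = \prod_(h < N) (8 * h + 9).
  rewrite /progP big_ord_recl mul1n; apply: eq_bigr => h _.
  by rewrite /= /bump /=; lia.
rewrite e -hf expnS expn1; apply/andP; split.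
  apply: leq_mul.
    by apply: (@prod_leq _ (fun h => h + 1) (fun h => 8 * h + 7)) => h; lia.
  by apply: (@prod_leq _ (fun h => h + 1) (fun h => 8 * h + 9)) => h; lia.
rewrite (_ : 81 = 9 * 9)// expnMn mulnACA.
apply: leq_mul.
  by apply: (@prod_leq_exp _ _ (fun h => 8 * h + 7) (fun h => h + 1)) => h; lia.
by apply: (@prod_leq_exp _ _ (fun h => 8 * h + 9) (fun h => h + 1)) => h; lia.
Qed.

Import Order.TTheory GRing.Theory Num.Theory.
Import numFieldNormedType.Exports.

(** * Pade approximation of the eighth root *)

Local Open Scope ring_scope.

Lemma alternating_binS (F : comPzRingType) (N : nat) (g : nat -> F) :
  \sum_(j < N.+2) (-1) ^+ j * 'C(N.+1, j)%:R * g j =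
  \sum_(j < N.+1) (-1) ^+ j * 'C(N, j)%:R * g j -
  \sum_(j < N.+1) (-1) ^+ j * 'C(N, j)%:R * g j.+1.
Proof.
have -> : \sum_(j < N.+1) (-1) ^+ j * 'C(N, j)%:R * g j =
          \sum_(j < N.+2) (-1) ^+ j * 'C(N, j)%:R * g j.
  by rewrite [RHS]big_ord_recr /= bin_small// mulr0 mul0r addr0.
rewrite big_ord_recl [in RHS]big_ord_recl /= !bin0 -addrA; congr (_ + _).
rewrite -sumrB; apply: eq_bigr => j _.
by rewrite /bump /= !add1n binS natrD exprS; ring.
Qed.

(** The identity at N+1 is the difference of the identities at N for x and x+1. *)
Lemma partial_fractions (F : numFieldType) (N : nat) (x : F) :
  (forall j, (j <= N)%N -> x + j%:R != 0) ->
  \sum_(j < N.+1) (-1) ^+ j * 'C(N, j)%:R * (x + j%:R)^-1 =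
  N`!%:R / \prod_(j < N.+1) (x + j%:R).
Proof.
elim: N x => [|N IH] x nz.
  by rewrite !big_ord1 /= expr0 !mul1r.
rewrite (alternating_binS _ (fun j => (x + j%:R)^-1)) IH; last first.
  by move=> j le; apply: nz; lia.
under [X in _ - X]eq_bigr => j _ do rewrite -natr1 [_ + 1]addrC addrA.
rewrite IH; last first.
  by move=> j le; rewrite -addrA [1 + _]addrC natr1; apply: nz.
rewrite big_ord_recl [in X in _ - X]big_ord_recr [in RHS]big_ord_recl /=.
rewrite [in RHS]big_ord_recr /=.
have e : \prod_(i < N) (x + (bump 0 i)%:R) = \prod_(i < N) (x + 1 + i%:R).
  by apply: eq_bigr => i _; rewrite /bump /= add1n -natr1 [_ + 1]addrC addrA.
rewrite e /bump /= add1n addr0.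
have nzM : \prod_(i < N) (x + 1 + i%:R) != 0.
  apply/prodf_neq0 => i _; rewrite -addrA [1 + _]addrC natr1; apply: nz; have := ltn_ord i; lia.
have nz0 : x != 0 by have := nz 0%N isT; rewrite addr0.
have nz1 : x + N.+1%:R != 0 by apply: nz.
have eN : x + 1 + N%:R = x + N.+1%:R by rewrite -addrA [1 + _]addrC natr1.
rewrite eN factS natrM.
by field; rewrite [1 + _]addrC natr1 nzM nz0 nz1.
Qed.

Lemma progression_signs (F : numFieldType) (N i : nat) : (i <= N)%N ->
  \prod_(j < N.+1) (i%:R - N%:R + 8^-1 + j%:R : F) =
  (-1) ^+ (N - i) * (8 ^- N.+1) * (progM (N - i) * progP i.+1)%:R.
Proof.
move=> /subnKC <-; move: (N - i)%N => d; rewrite addKn.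
rewrite (_ : (i + d).+1 = d + i.+1)%N; last lia.
rewrite big_split_ord /= natrM exprD invfM.
have -> : \prod_(j < d) (i%:R - (i + d)%:R + 8^-1 + j%:R : F) =
    (-1) ^+ d * 8 ^- d * (progM d)%:R.
  rewrite [LHS](reindex_inj rev_ord_inj) /= /progM natr_prod -exprVn -exprMn.
  rewrite -[in X in _ = X * _](card_ord d) -prodr_const -big_split /=.
  apply: eq_bigr => j _; rewrite natrB// -(natr1 j) (natrD _ i d).
  by rewrite (natrD _ (8 * j)) natrM; field.
have -> : \prod_(j < i.+1) (i%:R - (i + d)%:R + 8^-1 + (d + j)%:R : F) =
    8 ^- i.+1 * (progP i.+1)%:R.
  rewrite /progP natr_prod -exprVn.
  rewrite -[in X in _ = X * _](card_ord i.+1) -prodr_const -big_split /=.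
  apply: eq_bigr => j _; rewrite (natrD _ i d) (natrD _ d j).
  by rewrite (natrD _ (8 * j)) natrM; field.
by ring.
Qed.

Definition pade_scale (F : numFieldType) (N : nat) : F :=
  16 ^+ N * (progM N * progP N.+1)%:R / (N`!%:R ^+ 2 * 8 ^+ N.+1).

Lemma progM_gt0 (N : nat) : (0 < progM N)%N.
Proof. by rewrite /progM prodn_gt0// => h; lia. Qed.

Lemma progP_gt0 (N : nat) : (0 < progP N)%N.
Proof. by rewrite /progP prodn_gt0// => h; lia. Qed.

Lemma pade_coef_partial_fractions (F : numFieldType) (N i : nat) : (i <= N)%N ->
  pade_scale F N * ((-1) ^+ (N - i) * 'C(N, i)%:R *
    \sum_(j < N.+1) (-1) ^+ j * 'C(N, j)%:R * (i%:R - N%:R + 8^-1 + j%:R)^-1) =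
  (pade_coef N i)%:R.
Proof.
move=> iN.
have nz8 : (8 : F) != 0 by rewrite pnatr_eq0.
have nzM n : (progM n)%:R != 0 :> F by rewrite pnatr_eq0 -lt0n progM_gt0.
have nzP n : (progP n)%:R != 0 :> F by rewrite pnatr_eq0 -lt0n progP_gt0.
have nzf n : n`!%:R != 0 :> F by rewrite pnatr_eq0 -lt0n fact_gt0.
have nz : \prod_(j < N.+1) (i%:R - N%:R + 8^-1 + j%:R : F) != 0.
  by rewrite progression_signs// natrM !mulf_neq0 ?signr_eq0 ?invr_eq0 ?expf_neq0.
rewrite partial_fractions; last first.
  by move=> j jN; move/prodf_neq0: nz => /(_ (Ordinal (jN : (j < N.+1)%N)) isT).
have eC : N`!%:R = 'C(N, i)%:R * (i`!%:R * (N - i)`!%:R) :> F.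
  by rewrite -!natrM bin_fact.
have eU : (progM N)%:R = (progM (N - i))%:R * (progU N i)%:R :> F.
  by rewrite -natrM (progM_cat iN).
have eV : (progP N.+1)%:R = (progP i.+1)%:R * (progV N i)%:R :> F.
  by rewrite -natrM (progP_cat iN).
have eK : (pade_coef N i)%:R * (i`!%:R * (N - i)`!%:R) =
    16 ^+ N * ((progU N i)%:R * (progV N i)%:R) :> F.
  by rewrite -!natrM pade_coefE// !natrM natrX.
have nzF : i`!%:R * (N - i)`!%:R != 0 :> F by rewrite mulf_neq0.
have nzC : 'C(N, i)%:R != 0 :> F by rewrite pnatr_eq0 -lt0n bin_gt0.
apply: (mulIf nzF); rewrite eK progression_signs// /pade_scale !natrM.
rewrite eU eV eC; move: (nzM (N - i)%N) (nzP i.+1) (nzf i) (nzf (N - i)%N).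
have := signrE.
rewrite -(mulr1 (16 ^+ N * (_ * _))).
have sq : (-1) ^+ (N - i) / (-1) ^+ (N - i) = 1 :> F by rewrite divff ?signr_eq0.
have e8 : (8 : F) ^+ N.+1 != 0 by rewrite expf_neq0.
have es : (-1) ^+ (N - i) != 0 :> F by rewrite signr_eq0.
move: ((-1) ^+ (N - i)) (8 ^+ N.+1) (16 ^+ N) es e8 sq => S E X es e8 sq _ h1 h2 h3 h4.
by field; rewrite ?h1 ?h2 ?h3 ?h4 ?es ?e8 ?nzC.
Qed.

Definition pade_exponent (R : realType) (N i j : nat) : R :=
  i%:R - N%:R + 8^-1 + j%:R.

Definition pade_weight (R : realType) (N i j : nat) (w : R) : R :=
  (-1) ^+ (N - i) * 'C(N, i)%:R * ((-1) ^+ j * 'C(N, j)%:R) * w ^+ (N - j).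

(** A primitive of u |-> (u-1)^N (w-u)^N u^(1/8-N-1), expanded into powers of u;
    its increment from 1 to w is the remainder of the Pade approximation. *)
Definition pade_primitive (R : realType) (N : nat) (w : R) : R -> R :=
  \sum_(i < N.+1) \sum_(j < N.+1)
    (pade_weight N i j w / pade_exponent R N i j) \*:
      (fun u => u `^ pade_exponent R N i j).

Lemma pade_primitiveE (R : realType) (N : nat) (w u : R) :
  pade_primitive N w u = \sum_(i < N.+1) \sum_(j < N.+1)
    pade_weight N i j w / pade_exponent R N i j * u `^ pade_exponent R N i j.
Proof.
rewrite /pade_primitive fct_sumE; apply: eq_bigr => i _.
by rewrite fct_sumE.
Qed.

Lemma pade_exponent_neq0 (R : realType) (N i j : nat) :
  (i <= N)%N -> (j <= N)%N -> pade_exponent R N i j != 0.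
Proof.
move=> iN jN.
have : \prod_(j < N.+1) (i%:R - N%:R + 8^-1 + j%:R : R) != 0.
  rewrite progression_signs// natrM !mulf_neq0 ?signr_eq0 ?invr_eq0 ?expf_neq0//.
  - by rewrite pnatr_eq0 -lt0n progM_gt0.
  - by rewrite pnatr_eq0 -lt0n progP_gt0.
by move/prodf_neq0 => /(_ (Ordinal (jN : (j < N.+1)%N)) isT).
Qed.

Lemma is_derive_pade_primitive (R : realType) (N : nat) (w u : R) : 0 < u ->
  is_derive u 1 (pade_primitive N w)
    ((u - 1) ^+ N * (w - u) ^+ N * u `^ (8^-1 - N%:R - 1)).
Proof.
move=> u0.
have D : is_derive u 1 (pade_primitive N w)
   (\sum_(i < N.+1) \sum_(j < N.+1)
    (pade_weight N i j w / pade_exponent R N i j) *: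
      (pade_exponent R N i j * u `^ (pade_exponent R N i j - 1))).
  apply: is_derive_sum => i; apply: is_derive_sum => j; apply: is_deriveZ.
  exact: is_derive1_powR.
apply: (is_derive_eq D).
have e1 : (u - 1) ^+ N = \sum_(i < N.+1) (-1) ^+ (N - i) * 'C(N, i)%:R * u ^+ i.
  rewrite addrC exprDn; apply: eq_bigr => i _.
  by rewrite -mulr_natr mulrAC.
have e2 : (w - u) ^+ N =
    \sum_(j < N.+1) (-1) ^+ j * 'C(N, j)%:R * w ^+ (N - j) * u ^+ j.
  rewrite exprDn; apply: eq_bigr => i _.
  by rewrite -mulr_natr (exprNn u); ring.
rewrite e1 e2 big_distrlr /= mulr_suml; apply: eq_bigr => i _.
rewrite mulr_suml; apply: eq_bigr => j _.
have -> : pade_exponent R N i j - 1 = i%:R + j%:R + (8^-1 - N%:R - 1).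
  by rewrite /pade_exponent; ring.
have un0 : u != 0 by rewrite gt_eqF.
rewrite powRD ?un0 ?implybT// powRD ?un0 ?implybT// !powR_mulrn ?ltW//.
have nz : pade_exponent R N i j != 0.
  by apply: pade_exponent_neq0; rewrite -ltnS.
by rewrite /GRing.scale /= /pade_weight; field.
Qed.

Lemma pade_primitive_end (R : realType) (N : nat) (w : R) : 0 < w ->
  pade_scale R N * pade_primitive N w w =
  w `^ 8^-1 * \sum_(i < N.+1) (pade_coef N i)%:R * w ^+ i.
Proof.
move=> w0; rewrite pade_primitiveE mulr_sumr mulr_sumr; apply: eq_bigr => i _.
have iN : (i <= N)%N by rewrite -ltnS.
rewrite -(pade_coef_partial_fractions R iN).
rewrite !mulr_sumr !mulr_suml mulr_sumr; apply: eq_bigr => j _.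
have jN : (j <= N)%N by rewrite -ltnS.
have wn0 : w != 0 by rewrite gt_eqF.
have nz := @pade_exponent_neq0 R _ _ _ iN jN.
have -> : w `^ pade_exponent R N i j = w ^+ i * w ^- (N - j) * w `^ 8^-1.
  have -> : pade_exponent R N i j = i%:R + - (N - j)%:R + 8^-1.
    by rewrite /pade_exponent natrB//; ring.
  by rewrite !powRD ?wn0 ?implybT// powRN !powR_mulrn ?ltW.
rewrite -/(pade_exponent R N i j) /pade_weight.
have wx : w ^+ (N - j) != 0 by rewrite expf_neq0.
by field; rewrite wx nz.
Qed.

Lemma pade_primitive_start (R : realType) (N : nat) (w : R) :
  pade_scale R N * pade_primitive N w 1 =
  \sum_(i < N.+1) (pade_coef N i)%:R * w ^+ (N - i).
Proof.
rewrite pade_primitiveE exchange_big mulr_sumr; apply: eq_bigr => i _ /=.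
have iN : (i <= N)%N by rewrite -ltnS.
rewrite -(pade_coef_partial_fractions R iN).
rewrite !mulr_sumr !mulr_suml; apply: eq_bigr => j _.
have jN : (j <= N)%N by rewrite -ltnS.
have sg k : (k <= N)%N -> (-1) ^+ (N - k) = (-1) ^+ N * (-1) ^+ k :> R.
  by move=> kN; rewrite -{2}(subnK kN) exprD -mulrA -expr2 sqrr_sign mulr1.
have -> : pade_exponent R N j i = i%:R - N%:R + 8^-1 + j%:R.
  by rewrite /pade_exponent; ring.
by rewrite powR1 /pade_weight !sg//; ring.
Qed.

Lemma pade_increment (R : realType) (N : nat) (w x y : R) : 0 < x -> x < y ->
  exists2 c, x < c < y &
    pade_primitive N w y - pade_primitive N w x =
    (c - 1) ^+ N * (w - c) ^+ N * c `^ (8^-1 - N%:R - 1) * (y - x).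
Proof.
move=> x0 xy.
have [||c + ->] := @MVT R (pade_primitive N w)
  (fun u => (u - 1) ^+ N * (w - u) ^+ N * u `^ (8^-1 - N%:R - 1)) x y xy.
- move=> u; rewrite in_itv /= => /andP[xu _].
  by apply: is_derive_pade_primitive; apply: lt_trans xu.
- apply: derivable_within_continuous => u; rewrite in_itv /= => /andP[xu _].
  by case: (@is_derive_pade_primitive R N w u (lt_le_trans x0 xu)).
by rewrite in_itv /= => cxy; exists c.
Qed.

Lemma pade_scale_bounds (R : realType) (N : nat) :
  8^-1 <= pade_scale R N <= 162 ^+ N.
Proof.
have /andP[lo hi] := progMP_bounds N.
have f0 : 0 < N`!%:R ^+ 2 :> R by rewrite exprn_gt0// ltr0n fact_gt0.
have lo' : N`!%:R ^+ 2 <= (progM N * progP N.+1)%:R :> R.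
  by rewrite -natrX ler_nat.
have hi' : (progM N * progP N.+1)%:R <= 81 ^+ N * N`!%:R ^+ 2 :> R.
  by rewrite -!natrX -natrM ler_nat.
have e8 : 0 < 8 ^+ N :> R by rewrite exprn_gt0.
have e16 : 16 ^+ N = 2 ^+ N * 8 ^+ N :> R by rewrite -exprMn -natrM.
have e162 : 162 ^+ N = 2 ^+ N * 81 ^+ N :> R by rewrite -exprMn -natrM.
have e2 : 1 <= 2 ^+ N :> R by rewrite exprn_ege1// ler1n.
have e81 : 0 <= 81 ^+ N :> R by rewrite exprn_ge0.
rewrite /pade_scale (exprS 8) e16 e162.
move: (8 ^+ N) (81 ^+ N) (2 ^+ N) (N`!%:R ^+ 2) (_ * _)%:R {e16 e162} f0 lo' hi' e8 e2 e81.
move=> E E81 T F X f0 lo' hi' e8 e2 e81; apply/andP; split.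
  rewrite ler_pdivlMr; last by rewrite !mulr_gt0.
  rewrite (_ : 8^-1 * _ = 1 * E * F); last by field.
  by rewrite mul1r; apply: ler_pM; rewrite ?(ltW e8) ?(ltW f0) ?ler_peMl ?(ltW e8).
rewrite ler_pdivrMr; last by rewrite !mulr_gt0.
rewrite (_ : T * E81 * _ = T * E * (8 * (E81 * F))); last by ring.
rewrite ler_pM2l ?mulr_gt0//; last exact: lt_le_trans e2.
apply: (le_trans hi').
have : 0 <= E81 * F by rewrite mulr_ge0// ltW.
by move: (E81 * F) => z z0; lra.
Qed.

(** The remainder of the Pade approximation of w^(1/8) is an integral of a positive
    function; it is of exact order (w-1)^(2N+1), up to factors exponential in N. *)
Lemma pade_remainder (R : realType) (N : nat) (w : R) : 1 < w -> w <= 2 ->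
  (w - 1) ^+ (2 * N).+1 / (48 * 18 ^+ N) <=
  w `^ 8^-1 * \sum_(i < N.+1) (pade_coef N i)%:R * w ^+ i -
    \sum_(i < N.+1) (pade_coef N i)%:R * w ^+ (N - i)
  <= 162 ^+ N * (w - 1) ^+ (2 * N).+1.
Proof.
move=> w1 w2; rewrite -pade_primitive_end; last by lra.
rewrite -pade_primitive_start -mulrBr.
set h := w - 1; have h0 : 0 < h by rewrite /h; lra.
have /andP[k1 k2] := pade_scale_bounds R N.
have k0 : 0 < pade_scale R N by apply: lt_le_trans k1; lra.
have neg : 8^-1 - N%:R - 1 <= 0 :> R.
  have := ler0n R N; lra.
have pos (c x y : R) : 1 <= x -> x < c -> c < y -> y <= w ->
    0 <= (c - 1) ^+ N * (w - c) ^+ N * c `^ (8^-1 - N%:R - 1) * (y - x).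
  move=> *; rewrite !mulr_ge0 ?exprn_ge0 ?powR_ge0//; lra.
apply/andP; split; last first.
  have [|c /andP[c1 cw] ->] := @pade_increment R N w 1 w _ w1; first by lra.
  apply: ler_pM => //; first by rewrite ltW.
    by apply: pos.
  rewrite -/h exprS mulrC ler_pM2l// mul2n -addnn exprD.
  rewrite -[leRHS]mulr1; apply: ler_pM; rewrite ?mulr_ge0 ?exprn_ge0 ?powR_ge0//; try lra.
    apply: ler_pM; rewrite ?exprn_ge0//; try lra.
      by rewrite lerXn2r ?nnegrE//; rewrite /h; lra.
    by rewrite lerXn2r ?nnegrE//; rewrite /h; lra.
  by rewrite -[leRHS](powRr0 c) ler_powR//; lra.
pose x1 := 1 + h / 3; pose x2 := 1 + 2 * h / 3.
have [x10 x12 x2w] : [/\ 1 < x1, x1 < x2 & x2 < w] by rewrite /x1 /x2 /h; split; lra.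
have [c1 /andP[c11 c12] e1] := @pade_increment R N w 1 x1 ltr01 x10.
have [||c2 /andP[c21 c22] e2] := @pade_increment R N w x1 x2; [lra|lra|].
have [||c3 /andP[c31 c32] e3] := @pade_increment R N w x2 w; [lra|lra|].
have -> : pade_primitive N w w - pade_primitive N w 1 =
   (pade_primitive N w w - pade_primitive N w x2) +
   (pade_primitive N w x2 - pade_primitive N w x1) +
   (pade_primitive N w x1 - pade_primitive N w 1) by ring.
have p1 : 0 <= pade_primitive N w x1 - pade_primitive N w 1.
  by rewrite e1; apply: pos => //; lra.
have p3 : 0 <= pade_primitive N w w - pade_primitive N w x2.
  by rewrite e3; apply: pos => //; lra.
have p2 : (h / 3) ^+ N * (h / 3) ^+ N * 2 ^- N.+1 * (h / 3) <=
    pade_primitive N w x2 - pade_primitive N w x1.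
  rewrite e2; apply: ler_pM; rewrite ?mulr_ge0 ?exprn_ge0 ?invr_ge0//; try lra.
    apply: ler_pM; rewrite ?mulr_ge0 ?exprn_ge0 ?invr_ge0//; try lra.
      apply: ler_pM; rewrite ?exprn_ge0 ?lerXn2r ?nnegrE//;
        by move: c21 c22; rewrite /x1 /x2 /h; lra.
    apply: (@le_trans _ _ (c2 `^ (- (N%:R + 1)))).
      rewrite powRN natr1 powR_mulrn; last lra.
      rewrite lef_pV2 ?posrE ?exprn_gt0//; last lra.
      by rewrite lerXn2r ?nnegrE//; lra.
    by rewrite ler_powR//; lra.
  by rewrite /x1 /x2; lra.
have m0 : 0 <= (h / 3) ^+ N * (h / 3) ^+ N * 2 ^- N.+1 * (h / 3).
  have h3 : 0 <= h / 3 by lra.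
  have q3 : 0 <= (h / 3) ^+ N by apply: exprn_ge0.
  have q2 : 0 <= 2 ^- N.+1 :> R by rewrite invr_ge0 exprn_ge0.
  by apply: mulr_ge0 => //; apply: mulr_ge0 => //; apply: mulr_ge0.
apply: (@le_trans _ _ (8^-1 * ((h / 3) ^+ N * (h / 3) ^+ N * 2 ^- N.+1 * (h / 3)))).
  rewrite (_ : 18 = 3 * 3 * 2); last by rewrite -!natrM.
  rewrite !expr_div_n !exprMn !exprS mul2n -addnn exprD.
  have n3 : 3 ^+ N != 0 :> R by rewrite expf_neq0// pnatr_eq0.
  have n2 : 2 ^+ N != 0 :> R by rewrite expf_neq0// pnatr_eq0.
  move: (3 ^+ N) (2 ^+ N) (h ^+ N) n3 n2 => A B C n3 n2.
  rewrite le_eqVlt; apply/orP; left; apply/eqP; field; by rewrite n3 n2.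
apply: ler_pM => //.
move: p1 p2 p3; move: (_ - _) (_ - _) (_ - _) => P1 P2 P3; lra.
Qed.

(** * A gap principle for A X^8 - B Y^8 *)

Lemma leq_expl (m n e : nat) : (m <= n)%N -> (m ^ e <= n ^ e)%N.
Proof. by case: e => // e; rewrite leq_exp2r. Qed.

Lemma root8K (R : realType) (w : R) : 0 <= w -> (w `^ 8^-1) ^+ 8 = w.
Proof.
move=> w0; rewrite -powR_mulrn ?powR_ge0// -powRrM mulVf ?powRr1//.
Qed.

Definition pade_den (N V Z : nat) : nat :=
  (\sum_(i < N.+1) pade_coef N i * (V ^ i * Z ^ (N - i)))%N.

Lemma pade_denE (R : realType) (N V Z : nat) : (0 < Z)%N ->
  (pade_den N V Z)%:R =
  Z%:R ^+ N * \sum_(i < N.+1) (pade_coef N i)%:R * (V%:R / Z%:R) ^+ i :> R.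
Proof.
move=> Z0; rewrite natr_sum mulr_sumr; apply: eq_bigr => i _.
have iN : (i <= N)%N by rewrite -ltnS.
have Zn : Z%:R != 0 :> R by rewrite pnatr_eq0 -lt0n.
have e : Z%:R ^+ N = Z%:R ^+ (N - i) * Z%:R ^+ i :> R by rewrite -exprD subnK.
rewrite !natrM !natrX expr_div_n e.
by have := expf_neq0 i Zn; move: (Z%:R ^+ i) => Zi Zi0; field.
Qed.

Definition pade_num (N V Z : nat) : nat :=
  (\sum_(i < N.+1) pade_coef N i * (V ^ (N - i) * Z ^ i))%N.

Lemma pade_numE (R : realType) (N V Z : nat) : (0 < Z)%N ->
  (pade_num N V Z)%:R =
  Z%:R ^+ N * \sum_(i < N.+1) (pade_coef N i)%:R * (V%:R / Z%:R) ^+ (N - i) :> R.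
Proof.
move=> Z0; rewrite natr_sum mulr_sumr; apply: eq_bigr => i _.
have iN : (i <= N)%N by rewrite -ltnS.
have Zn : Z%:R != 0 :> R by rewrite pnatr_eq0 -lt0n.
have e : Z%:R ^+ N = Z%:R ^+ (N - i) * Z%:R ^+ i :> R by rewrite -exprD subnK.
rewrite !natrM !natrX expr_div_n e.
by have := expf_neq0 (N - i) Zn; move: (Z%:R ^+ (N - i)) => Zi Zi0; field.
Qed.

Lemma pade_num_le (N V Z : nat) : (V <= 2 * Z)%N ->
  (pade_num N V Z <= N.+1 * (1152 ^ N * Z ^ N))%N.
Proof.
move=> VZ; have {1}-> : N.+1 = #|'I_N.+1| by rewrite card_ord.
rewrite -sum_nat_const; apply: leq_sum => i _.
have iN : (i <= N)%N by rewrite -ltnS.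
rewrite (_ : 1152 = 576 * 2)%N// expnMn -mulnA leq_mul ?pade_coef_le//.
have -> : (Z ^ N = Z ^ (N - i) * Z ^ i)%N by rewrite -expnD subnK.
rewrite mulnA leq_mul// (leq_trans (leq_expl _ VZ))// expnMn leq_mul//.
by rewrite leq_exp2l// leq_subr.
Qed.

(** With V = A X0^8 and Z = B Y0^8, the Pade approximation of (V/Z)^(1/8) gives a
    fraction (pade_num * Y0) / (pade_den * X0) close to (A/B)^(1/8). The last two
    hypotheses say that this fraction is too close to Y1/X1 for two different
    fractions with these denominators, and that it is not Y1/X1, because its
    distance to (A/B)^(1/8) is bounded from below. *)
Lemma thue_core (R : realType) (A B X0 Y0 X1 Y1 N : nat) :
  (0 < A)%N -> (0 < B)%N -> (0 < Y0)%N -> (0 < Y1)%N ->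
  (B * Y0 ^ 8 < A * X0 ^ 8 <= B * Y0 ^ 8 + Y0)%N ->
  (B * Y1 ^ 8 < A * X1 ^ 8 <= B * Y1 ^ 8 + Y1)%N ->
  (Y0 * X1 * 162 ^ N * Y0 ^ (2 * N).+1 < (B * Y0 ^ 8) ^ N.+1)%N ->
  (N.+1 * 1152 ^ N * (48 * 18 ^ N) * (B * Y0 ^ 8) ^ (2 * N).+1 * Y1 < B * Y1 ^ 8)%N ->
  False.
Proof.
move=> A0 B0 Y00 Y10 /andP[lt0 le0] /andP[lt1 le1] c1 c2.
set V := (A * X0 ^ 8)%N in lt0 le0; set Z := (B * Y0 ^ 8)%N in lt0 le0 c1 c2.
set V1 := (A * X1 ^ 8)%N in lt1 le1; set Z1 := (B * Y1 ^ 8)%N in lt1 le1 c2.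
have Z0 : (0 < Z)%N by rewrite /Z muln_gt0 B0 expn_gt0 Y00.
have Z10 : (0 < Z1)%N by rewrite /Z1 muln_gt0 B0 expn_gt0 Y10.
have Y0Z : (Y0 <= Z)%N by rewrite /Z expnS mulnCA leq_pmulr// muln_gt0 B0 expn_gt0 Y00.
have Z0R : 0 < Z%:R :> R by rewrite ltr0n.
have Z1R : 0 < Z1%:R :> R by rewrite ltr0n.
set w : R := V%:R / Z%:R; set w1 : R := V1%:R / Z1%:R.
have w_gt1 : 1 < w by rewrite /w ltr_pdivlMr// mul1r ltr_nat.
have w1_gt1 : 1 < w1 by rewrite /w1 ltr_pdivlMr// mul1r ltr_nat.
have VZ : (V <= 2 * Z)%N by rewrite mul2n -addnn (leq_trans le0)// leq_add2l.
have w_le2 : w <= 2 by rewrite /w ler_pdivrMr// -natrM ler_nat.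
have hlo : Z%:R^-1 <= w - 1.
  rewrite -(ler_pM2r Z0R) mulrBl mulVf ?gt_eqF// /w mulfVK ?gt_eqF// mul1r.
  by rewrite lerBrDr addrC natr1 ler_nat.
have hhi : w - 1 <= Y0%:R / Z%:R.
  rewrite -(ler_pM2r Z0R) mulrBl /w !mulfVK ?gt_eqF// mul1r.
  by rewrite lerBlDr -natrD ler_nat addnC.
have w1hi : w1 - 1 <= Y1%:R / Z1%:R.
  rewrite -(ler_pM2r Z1R) mulrBl /w1 !mulfVK ?gt_eqF// mul1r.
  by rewrite lerBlDr -natrD ler_nat addnC.
have h0 : 0 < w - 1 by rewrite subr_gt0.
have /andP[lo hi] := pade_remainder N w_gt1 w_le2.
set al := w `^ 8^-1 in lo hi; set al1 := w1 `^ 8^-1.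
have al0 : 0 <= al by apply: powR_ge0.
have al10 : 0 <= al1 by apply: powR_ge0.
have al8 : al ^+ 8 = w by rewrite root8K//; lra.
have al18 : al1 ^+ 8 = w1 by rewrite root8K//; lra.
have al1_ge1 : 1 <= al1.
  by rewrite -(@ler_pXn2r _ 8)// ?nnegrE// expr1n al18 ltW.
have al1_le : al1 - 1 <= Y1%:R / Z1%:R.
  apply: le_trans w1hi; rewrite lerB// -al18 -{1}[al1]expr1.
  exact: ler_weXn2l.
pose q := pade_den N V Z; pose p := pade_num N V Z.
have ZN0 : 0 < Z%:R ^+ N :> R by rewrite exprn_gt0.
have ratio : al * (Y0 * X1)%:R = al1 * (X0 * Y1)%:R.
  apply/eqP; rewrite -(@eqrXn2 _ 8)// ?mulr_ge0//; apply/eqP.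
  rewrite !exprMn al8 al18 /w /w1 /V /Z /V1 /Z1 !natrM ?natrX.
  have ? : A%:R != 0 :> R by rewrite pnatr_eq0 -lt0n.
  have ? : B%:R != 0 :> R by rewrite pnatr_eq0 -lt0n.
  have ? : Y0%:R != 0 :> R by rewrite pnatr_eq0 -lt0n.
  have ? : Y1%:R != 0 :> R by rewrite pnatr_eq0 -lt0n.
  by field; apply/and3P; split.
set L := Z%:R ^+ N * (al * \sum_(i < N.+1) (pade_coef N i)%:R * w ^+ i -
    \sum_(i < N.+1) (pade_coef N i)%:R * w ^+ (N - i)).
have LE : L = al * q%:R - p%:R.
  by rewrite /L /q /p (pade_denE R) // (pade_numE R)// mulrBr mulrCA.
have key : al1 * ((q * (X0 * Y1))%:R - (p * (Y0 * X1))%:R) =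
    (Y0 * X1)%:R * (L - p%:R * (al1 - 1)).
  rewrite LE; move: ratio; rewrite !(natrM _ q) !(natrM _ p).
  move: (_ * _)%:R (_ * _)%:R => U W e.
  by rewrite mulrBr mulrCA -e; ring.
have X10 : (0 < X1)%N.
  by rewrite lt0n; apply/eqP => e; move: lt1; rewrite /V1 e exp0n// muln0.
have YX0 : 0 < (Y0 * X1)%:R :> R by rewrite ltr0n muln_gt0 Y00.
have up : (Y0 * X1)%:R * L < 1.
  apply: (@le_lt_trans _ _ ((Y0 * X1)%:R * (Z%:R ^+ N * (162 ^+ N * (Y0%:R / Z%:R) ^+ (2 * N).+1)))).
    rewrite ler_pM2l// ler_pM2l//; apply: (le_trans hi).
    rewrite ler_pM2l ?exprn_gt0// lerXn2r// nnegrE; first exact: ltW.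
    by rewrite divr_ge0.
  have eZ : Z%:R ^+ (2 * N).+1 = Z%:R ^+ N * Z%:R ^+ N.+1 :> R.
    by rewrite -exprD addnS mul2n addnn.
  rewrite expr_div_n eZ.
  rewrite (_ : _ * _ = (Y0 * X1 * 162 ^ N * Y0 ^ (2 * N).+1)%:R / Z%:R ^+ N.+1).
    by rewrite ltr_pdivrMr ?exprn_gt0// mul1r -natrX ltr_nat.
  have -> : (Y0 * X1 * 162 ^ N * Y0 ^ (2 * N).+1)%:R =
      (Y0 * X1)%:R * 162 ^+ N * Y0%:R ^+ (2 * N).+1 :> R.
    by rewrite natrM natrX natrM natrX.
  have : Z%:R ^+ N.+1 != 0 :> R by rewrite gt_eqF// exprn_gt0.
  have : Z%:R ^+ N != 0 :> R by rewrite gt_eqF.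
  move: (Z%:R ^+ N) (Z%:R ^+ N.+1) => z z' nz nz'; field; by rewrite nz nz'.
have low : p%:R * (al1 - 1) < L.
  apply: (@le_lt_trans _ _ ((N.+1 * (1152 ^ N * Z ^ N))%:R * (Y1%:R / Z1%:R))).
    apply: ler_pM => //; first by rewrite subr_ge0.
    by rewrite ler_nat; apply: pade_num_le.
  apply: (@lt_le_trans _ _ (Z%:R ^+ N * (Z%:R^-1 ^+ (2 * N).+1 / (48 * 18 ^+ N)))); last first.
    rewrite /L ler_pM2l//; apply: le_trans lo.
    rewrite ler_pM2r ?invr_gt0 ?mulr_gt0 ?exprn_gt0// lerXn2r// nnegrE.
    - by rewrite invr_ge0.
    - exact: ltW.
  rewrite (natrM _ N.+1) (natrM _ (1152 ^ N)) (natrX _ Z).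
  rewrite (_ : _ * _ = Z%:R ^+ N * ((N.+1 * 1152 ^ N)%:R * Y1%:R / Z1%:R)); last first.
    by rewrite (natrM _ N.+1); ring.
  rewrite ltr_pM2l// exprVn ltr_pdivlMr ?mulr_gt0 ?exprn_gt0//.
  rewrite mulrAC ltr_pdivrMr// [ltRHS]mulrC ltr_pdivlMr ?exprn_gt0//.
  have <- : (48 * 18 ^ N)%:R = 48 * 18 ^+ N :> R by rewrite natrM natrX.
  rewrite -(natrX _ Z) -!natrM ltr_nat.
  by apply: leq_ltn_trans c2; rewrite eq_leq//; ring.
have pos : 0 < al1 * ((q * (X0 * Y1))%:R - (p * (Y0 * X1))%:R).
  by rewrite key mulr_gt0// subr_gt0.
have D0 : (p * (Y0 * X1) < q * (X0 * Y1))%N.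
  by move: pos; rewrite pmulr_rgt0 ?subr_gt0 ?ltr_nat//; lra.
have D1 : 1 <= (q * (X0 * Y1))%:R - (p * (Y0 * X1))%:R :> R.
  by rewrite -natrB ?ler1n ?subn_gt0// ltnW.
have : 1 <= al1 * ((q * (X0 * Y1))%:R - (p * (Y0 * X1))%:R).
  by rewrite -[leLHS]mulr1; apply: ler_pM.
rewrite key leNgt => /negP; apply; apply: le_lt_trans up.
by rewrite ler_pM2l// gerBl mulr_ge0// subr_ge0.
Qed.

Local Close Scope ring_scope.

(** Two solutions of 0 < A X^8 - B Y^8 <= Y cannot be far apart: the degree N is
    chosen so that Y1 lies between Y0^(5N) and Y0^(5N+5). *)
Lemma thue_gap (R : realType) (A B : nat) : 0 < A -> 0 < B ->
  exists M, forall X0 Y0 X1 Y1, M <= Y0 -> Y0 ^ 5 < Y1 ->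
    B * Y0 ^ 8 < A * X0 ^ 8 <= B * Y0 ^ 8 + Y0 ->
    B * Y1 ^ 8 < A * X1 ^ 8 <= B * Y1 ^ 8 + Y1 -> False.
Proof.
(* The factor 1152 * 36 = 2 * 1152 * 18 makes Y0^N absorb the factors N+1 <= 2^N,
   1152^N (Pade coefficients and V <= 2 Z) and 18^N (remainder). *)
move=> A0 B0; exists (1152 * 36 + 2 * B) => X0 Y0 X1 Y1 MY gap s0 s1.
have [Y0B Y0c] : 2 * B < Y0 /\ 1152 * 36 <= Y0 by split; lia.
have Y01 : 1 < Y0 by apply: leq_trans Y0c.
have pos e : 0 < Y0 ^ e by rewrite expn_gt0 ltnW.
have [N N0 /andP[lo hi]] : exists2 N, 0 < N & Y0 ^ (5 * N) < Y1 <= Y0 ^ (5 * N.+1).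
  have ub n : Y0 ^ (5 * n) < Y1 -> n <= Y1.
    move=> lt; apply/ltnW/(leq_trans _ (ltnW lt)).
    by apply: (leq_trans (ltn_expl n Y01)); rewrite leq_exp2l//; lia.
  have ex : exists n, Y0 ^ (5 * n) < Y1 by exists 1; rewrite muln1.
  case: (ex_maxnP ex ub) => N lt mx; exists N; first by apply: mx; rewrite muln1.
  by rewrite lt /= leqNgt; apply/negP => /mx; rewrite ltnn.
have X1Y : X1 <= 2 * B * Y1.
  rewrite -(@leq_exp2r _ _ 8)//; apply: (@leq_trans (A * X1 ^ 8)).
    by rewrite leq_pmull.
  case/andP: s1 => _ /leq_trans; apply.
  have : Y1 <= Y1 ^ 8 by rewrite -{1}[Y1]expn1 leq_pexp2l//; lia.
  have : B <= B ^ 8 by rewrite -{1}[B]expn1 leq_pexp2l//.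
  rewrite !expnMn; move: (B ^ 8) (Y1 ^ 8) => b y bB yY; nia.
have Y10 : 0 < Y1 by lia.
have powc k c : c <= Y0 -> c ^ k <= Y0 ^ k by apply: leq_expl.
apply: (@thue_core R A B X0 Y0 X1 Y1 N) => //; first by lia.
- have h : Y0 * X1 * 162 ^ N * Y0 ^ (2 * N).+1 < (Y0 ^ 8) ^ N.+1.
    have -> : (Y0 ^ 8) ^ N.+1 = Y0 * (Y0 * Y0 ^ (5 * N.+1)) * Y0 ^ N * Y0 ^ (2 * N).+1.
      rewrite -expnM -!expnS -!expnD; congr (_ ^ _); lia.
    rewrite ltn_pmul2r//; apply: (@leq_ltn_trans (Y0 * X1 * Y0 ^ N)).
      by rewrite leq_mul// powc//; lia.
    rewrite ltn_pmul2r// ltn_pmul2l; last by lia.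
    apply: (leq_ltn_trans X1Y); apply: (@leq_ltn_trans (2 * B * Y0 ^ (5 * N.+1))).
      by rewrite leq_mul.
    by rewrite ltn_pmul2r.
  apply: (leq_trans h); apply: leq_expl; exact: leq_pmull.
- have Z9 : B * Y0 ^ 8 <= Y0 ^ 9 by rewrite (expnS _ 8) leq_mul//; lia.
  have cst : N.+1 * 1152 ^ N * (48 * 18 ^ N) <= Y0 ^ N.+1.
    apply: (@leq_trans (48 * (1152 * 36) ^ N)).
      rewrite (_ : 36 = 2 * 18)// !expnMn.
      have := ltn_expl N (ltnSn 1).
      move: (1152 ^ N) (18 ^ N) (2 ^ N) => a b c c1.
      rewrite (_ : _ * a * _ = 48 * (N.+1 * a * b)); last by ring.
      by rewrite leq_pmul2l// -mulnA mulnCA leq_mul// leq_mul.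
    by rewrite expnS; apply: leq_mul; [lia | apply: powc].
  apply: (@leq_ltn_trans (Y0 ^ N.+1 * (Y0 ^ 9) ^ (2 * N).+1 * Y1)).
    by rewrite leq_mul// leq_mul// leq_expl.
  apply: (@leq_trans (Y1 ^ 8)); last exact: leq_pmull.
  rewrite (expnSr _ 7) ltn_pmul2r//.
  apply: (@leq_ltn_trans ((Y0 ^ (5 * N)) ^ 7)); last by rewrite ltn_exp2r.
  by rewrite -!expnM -expnD leq_exp2l//; lia.
Qed.

(** * The equation g' r^i (r^d - 1) = g s^i' (s^d' - 1) *)

Lemma pigeonhole_decreasing (C : finType) (P : nat -> C -> Prop) :
  (forall k l c, k <= l -> P l c -> P k c) -> (forall k, exists c, P k c) ->
  exists c, forall k, P k c.
Proof.
move=> mono ex; apply: contrapT => no.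
have /choice[f fP] c : exists k, ~ P k c.
  by apply: contrapT => none; apply: no; exists c => k; apply: contrapT => nP;
    apply: none; exists k.
have [c Pc] := ex (\max_c f c); apply: (fP c); apply: mono Pc.
exact: leq_bigmax.
Qed.

(** Splitting the exponents modulo 8 turns g' r^m and g s^m' into A X^8 and B Y^8
    with finitely many possible pairs (A, B), so infinitely many solutions would
    produce two solutions with the same (A, B) and an arbitrarily large gap. *)
Lemma near_powers (R : realType) (r s G : nat) : 1 < r -> 1 < s ->
  exists N, forall g g' m m', 0 < g <= G -> 0 < g' <= G -> N <= m -> N <= m' ->
    g' * r ^ m <> g * s ^ m' ->
    g' * r ^ m <= g * s ^ m' + s ^ (m' %/ 8) ->
    g * s ^ m' <= g' * r ^ m + r ^ (m %/ 8) -> False.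
Proof.
move=> r1 s1; apply: contrapT => no.
pose C : finType := ('I_G.+1 * 'I_G.+1 * ('I_8 * 'I_8) * bool)%type.
pose P k (c : C) := let: (g, g', (d, d'), b) := c in
  exists m m', [/\ [/\ k <= m, k <= m', 0 < g & 0 < g'],
    m %% 8 = d, m' %% 8 = d' &
    if b then g * s ^ m' < g' * r ^ m <= g * s ^ m' + s ^ (m' %/ 8)
    else g' * r ^ m < g * s ^ m' <= g' * r ^ m + r ^ (m %/ 8)].
have [||[[[g g'] [d d']] b] Pc] := @pigeonhole_decreasing C P.
- move=> k l [[[g g'] [d d']] b] kl [m [m' [[lm lm' g0 g'0] dm dm' h]]].
  by exists m, m'; split=> //; split=> //; lia.
- move=> k; apply: contrapT => none; apply: no.
  exists k => g g' m m' /andP[g0 gG] /andP[g'0 g'G] km km' ne le1 le2.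
  apply: none.
  exists (Ordinal (gG : g < G.+1), Ordinal (g'G : g' < G.+1),
    (Ordinal (ltn_pmod m (isT : 0 < 8)), Ordinal (ltn_pmod m' (isT : 0 < 8))),
    g * s ^ m' < g' * r ^ m).
  exists m, m'; split=> //; case: ltnP => //= le.
  by rewrite ltn_neqAle le le2 andbT; move/eqP: ne => ->.
have split8 (a p m : nat) : a * p ^ m = a * p ^ (m %% 8) * (p ^ (m %/ 8)) ^ 8.
  by rewrite -mulnA -expnM -expnD addnC -divn_eq.
have big p k : 1 < p -> exists n, forall m, n <= m -> k < p ^ (m %/ 8).
  move=> p1; exists (8 * k) => m km.
  apply: leq_ltn_trans (ltn_expl _ p1); rewrite leq_divRL//; lia.
have [_ [_ [[_ _ g0 g'0] _ _ _]]] := Pc 0.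
have p0 e : 0 < r ^ e by rewrite expn_gt0 ltnW.
have q0 e : 0 < s ^ e by rewrite expn_gt0 ltnW.
case: b Pc => Pc.
- have [||M MP] := @thue_gap R (g' * r ^ d) (g * s ^ d'); rewrite ?muln_gt0 ?g'0 ?g0 ?p0 ?q0//.
  have [n0 n0P] := big s M s1.
  have [m0 [m0' [[_ k0 _ _] e0 e0' h0]]] := Pc n0.
  have [n1 n1P] := big s ((s ^ (m0' %/ 8)) ^ 5) s1.
  have [m1 [m1' [[_ k1 _ _] e1 e1' h1]]] := Pc n1.
  apply: (MP (r ^ (m0 %/ 8)) (s ^ (m0' %/ 8)) (r ^ (m1 %/ 8)) (s ^ (m1' %/ 8))).
  + exact/ltnW/n0P.
  + exact: n1P.
  + by rewrite -e0 -e0' -!split8.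
  + by rewrite -e1 -e1' -!split8.
- have [||M MP] := @thue_gap R (g * s ^ d') (g' * r ^ d); rewrite ?muln_gt0 ?g'0 ?g0 ?p0 ?q0//.
  have [n0 n0P] := big r M r1.
  have [m0 [m0' [[k0 _ _ _] e0 e0' h0]]] := Pc n0.
  have [n1 n1P] := big r ((r ^ (m0 %/ 8)) ^ 5) r1.
  have [m1 [m1' [[k1 _ _ _] e1 e1' h1]]] := Pc n1.
  apply: (MP (s ^ (m0' %/ 8)) (r ^ (m0 %/ 8)) (s ^ (m1' %/ 8)) (r ^ (m1 %/ 8))).
  + exact/ltnW/n0P.
  + exact: n1P.
  + by rewrite -e0 -e0' -!split8.
  + by rewrite -e1 -e1' -!split8.
Qed.

Lemma exp_gt1 (a k : nat) : 1 < a -> 0 < k -> 1 < a ^ k.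
Proof. by move=> a1 k0; have := ltn_exp2r 1 a k0; rewrite exp1n => ->. Qed.

Lemma modn_sum_pow (q T d : nat) : T = 1 %[mod q] ->
  \sum_(i < d) T ^ i = d %[mod q].
Proof.
move=> T1; elim: d => [|d IH]; first by rewrite big_ord0.
rewrite big_ord_recr /= -modnDm IH -(modnXm d) T1 modnXm exp1n modnDm addn1.
by [].
Qed.

(** Lifting the exponent: T^d - 1 = (T - 1)(1 + T + ... + T^(d-1)), where the last
    factor is d modulo p^2, hence a unit at p if p does not divide d and exactly
    divisible by p if d = p. *)
Lemma logn_pow_pred (p T d : nat) : prime p -> 1 < T -> T = 1 %[mod p ^ 2] ->
  0 < d -> logn p (T ^ d).-1 = logn p T.-1 + logn p d.
Proof.
move=> pp; have p1 := prime_gt1 pp; have p0 := prime_gt0 pp.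
elim/ltn_ind: d T => d IH T T1 Tp d0.
have T0 : 0 < T.-1 by lia.
have sum0 k : 0 < k -> 0 < \sum_(i < k) T ^ i.
  by case: k => // k _; rewrite big_ord_recl expn0.
have Tp1 : T = 1 %[mod p].
  by rewrite -(@modn_dvdm (p ^ 2) T p) ?Tp ?modn_dvdm// expnS dvdn_mulr.
have [/dvdnP[e de]|nd] := boolP (p %| d); last first.
  rewrite predn_exp lognM ?sum0//; congr (_ + _).
  rewrite (lognE p d) (negbTE nd) !andbF lognE /dvdn (modn_sum_pow d Tp1).
  by rewrite -/(p %| d) (negbTE nd) !andbF.
have e0 : 0 < e by case: e de d0 => [->|].
have Sp : logn p (\sum_(i < p) T ^ i) = 1.
  have := modn_sum_pow p Tp; set S := \sum_(i < p) _ => eS.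
  have S0 : 0 < S by apply: sum0.
  apply/eqP; rewrite eqn_leq; apply/andP; split.
    rewrite leqNgt -pfactor_dvdn// /dvdn eS modn_small -?lt0n//.
    by rewrite -{1}[p]expn1 ltn_exp2l.
  rewrite -pfactor_dvdn// expn1 /dvdn -(@modn_dvdm (p ^ 2)) ?eS; last first.
    by rewrite expnS dvdn_mulr.
  by rewrite modn_dvdm ?modnn// expnS dvdn_mulr.
rewrite de mulnC expnM (IH e) //; last 3 first.
- by rewrite de -{1}[e]muln1 ltn_pmul2l.
- exact: exp_gt1.
- by rewrite -modnXm Tp modnXm exp1n.
by rewrite predn_exp !lognM ?sum0// Sp (logn_prime p pp) eqxx addnA.
Qed.

Lemma logn_pow_pred_le (p r : nat) : prime p -> 1 < r ->
  exists K, forall d, 0 < d -> logn p (r ^ d).-1 <= K + trunc_log 2 d.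
Proof.
move=> pp r1; have [pr|npr] := boolP (p %| r).
  exists 0 => d d0; rewrite lognE pp /=; case: ifP => // /andP[_].
  have : p %| r ^ d by rewrite Euclid_dvdX// pr.
  have rd : 0 < r ^ d by rewrite expn_gt0 ltnW.
  rewrite -{1}(prednK rd) -addn1 => h1 h2.
  by rewrite dvdn_addr// dvdn1 in h1; move/eqP: h1 pp => ->.
have co : coprime r (p ^ 2) by rewrite coprimeXr// coprime_sym prime_coprime.
have h0 : 0 < totient (p ^ 2) by rewrite totient_gt0 expn_gt0 prime_gt0.
pose T := r ^ totient (p ^ 2).
have T1 : 1 < T by apply: exp_gt1.
exists (logn p T.-1) => d d0.
have pos k : 0 < k -> 0 < (r ^ k).-1.
  by move=> k0; have := exp_gt1 r1 k0; lia.
apply: (@leq_trans (logn p (T ^ d).-1)).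
  apply: dvdn_leq_log; rewrite /T -expnM; first by rewrite pos// muln_gt0 h0.
  by rewrite mulnC expnM [X in _ %| X]predn_exp dvdn_mulr.
rewrite logn_pow_pred ?Euler_exp_totient// leq_add2l.
apply: trunc_log_max => //; apply: (@leq_trans (p ^ logn p d)).
  by apply: leq_expl; apply: prime_gt1.
by apply: dvdn_leq => //; apply: pfactor_dvdnn.
Qed.

Definition multiplicatively_independent (r s : nat) : Prop :=
  forall u v, 0 < u -> 0 < v -> r ^ u <> s ^ v.

(** Proportional vectors of valuations would give r^a = s^b, where a and b are the
    valuations of s and r at a prime factor of r. *)
Lemma independent_logn (r s : nat) : 1 < r -> 1 < s ->
  multiplicatively_independent r s ->
  exists p q, [/\ prime p, prime q &
    logn p r * logn q s <> logn q r * logn p s].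
Proof.
move=> r1 s1 ind; apply: contrapT => no.
have prop p q : prime p -> prime q ->
    logn p r * logn q s = logn q r * logn p s.
  by move=> pp qp; apply: contrapT => ne; apply: no; exists p, q.
have pr := pdiv_prime r1; have ps := pdiv_prime s1.
have a0 : 0 < logn (pdiv r) r by rewrite logn_gt0 mem_primes pr pdiv_dvd ltnW.
have b0 : 0 < logn (pdiv s) s by rewrite logn_gt0 mem_primes ps pdiv_dvd ltnW.
have c0 : 0 < logn (pdiv r) s.
  by have := prop _ _ pr ps; rewrite lt0n; case: eqP => // ->; nia.
apply: (ind _ _ c0 a0); apply: eqn_from_log => [||p].
- by rewrite expn_gt0 (ltnW r1).
- by rewrite expn_gt0 (ltnW s1).
rewrite !lognX; have [pp|np] := boolP (prime p).
  by rewrite mulnC -prop// mulnC.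
by rewrite (lognE p r) (lognE p s) (negbTE np) /= !muln0.
Qed.

Lemma linear_lt_exp2 (a b : nat) : exists L, forall l, L <= l -> a + b * l < 2 ^ l.
Proof.
exists (2 * (a + 2 * b) + 1) => l le.
have h := odd_double_half l; set k := l./2 in h.
have : 2 ^ (k + k) <= 2 ^ l by rewrite leq_exp2l//; lia.
have := ltn_expl k (ltnSn 1); rewrite expnD; move: (2 ^ k) (2 ^ l) => x y.
move=> kx xy; have xx := leq_mul kx kx.
have kl : a + 2 * b <= k by case: (odd l) h => /= h; lia.
have kk := leq_mul kl (leqnn k.+1).
by case: (odd l) h => /= h; nia.
Qed.

Lemma log_lt_linear (a b c : nat) : exists N, forall n, N <= n ->
  a + b * trunc_log 2 (c * n) <= n.
Proof.
have [L LP] := linear_lt_exp2 (c * a) (c * b).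
exists (a + b * L + 1) => n le; rewrite leqNgt; apply/negP => gt.
have [c0|c0] := posnP c.
  by rewrite c0 mul0n trunc_log0 in gt; lia.
set l := trunc_log 2 (c * n) in gt.
have l2 : 2 ^ l <= c * n by apply: trunc_logP => //; rewrite muln_gt0 c0; lia.
have [Ll|Ll] := leqP L l; last by nia.
by have := LP _ Ll; nia.
Qed.

Lemma determinant_bound (a1 b1 a2 b2 i j E : nat) : a1 * b2 <> a2 * b1 ->
  a1 * i <= b1 * j + E -> b1 * j <= a1 * i + E ->
  a2 * i <= b2 * j + E -> b2 * j <= a2 * i + E ->
  i <= E * (b1 + b2) /\ j <= E * (a1 + a2).
Proof.
move=> ne h1 h2 h3 h4.
have k1 := leq_mul (leqnn b2) h1; have k2 := leq_mul (leqnn b2) h2.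
have k3 := leq_mul (leqnn b1) h3; have k4 := leq_mul (leqnn b1) h4.
have l1 := leq_mul (leqnn a2) h1; have l2 := leq_mul (leqnn a2) h2.
have l3 := leq_mul (leqnn a1) h3; have l4 := leq_mul (leqnn a1) h4.
have [lt|lt|//] := ltngtP (a1 * b2) (a2 * b1).
  have q1 := leq_mul lt (leqnn i); have q2 := leq_mul lt (leqnn j); split; nia.
have q1 := leq_mul lt (leqnn i); have q2 := leq_mul lt (leqnn j); split; nia.
Qed.

Lemma exponent_compare (r s G H g g' i d i' d' : nat) :
  1 < r -> 1 < s -> r <= 2 ^ H -> G <= 2 ^ H ->
  0 < g <= G -> 0 < g' <= G -> 0 < d -> 0 < d' ->
  g' * (r ^ i * (r ^ d).-1) = g * (s ^ i' * (s ^ d').-1) ->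
  i' + d' <= (2 * H + 1) * (i + d).
Proof.
move=> r1 s1 rH GH /andP[g0 gG] /andP[g'0 g'G] d0 d'0 e.
have lo : 2 ^ (i' + d').-1 <= g * (s ^ i' * (s ^ d').-1).
  have -> : (i' + d').-1 = i' + d'.-1 by lia.
  apply: (@leq_trans (s ^ (i' + d'.-1))); first exact: leq_expl.
  rewrite expnD; apply: (leq_trans _ (leq_pmull _ g0)); rewrite leq_mul//.
  have : s ^ d'.-1 < s ^ d' by rewrite ltn_exp2l//; lia.
  by move: (s ^ d'.-1) (s ^ d') => *; lia.
have hi : g' * (r ^ i * (r ^ d).-1) <= 2 ^ (H + H * (i + d)).
  rewrite expnD expnM; apply: leq_mul; first exact: leq_trans g'G GH.
  apply: (@leq_trans (r ^ (i + d))); last exact: leq_expl.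
  by rewrite expnD leq_mul// leq_pred.
have := leq_trans lo (leq_trans (eq_leq (esym e)) hi).
by rewrite leq_exp2l//; nia.
Qed.

(** In g' r^i (r^d - 1) = g s^i' (s^d' - 1), comparing the p-adic valuations for
    two primes p with independent pairs (v_p(r), v_p(s)) gives two linear forms
    in i, i' of logarithmic size, so i and i' are logarithmic. Then g' r^(i+d) and
    g s^(i'+d') are too close to each other. *)
Lemma sunit_equation (R : realType) (r s G : nat) : 1 < r -> 1 < s ->
  multiplicatively_independent r s ->
  exists N, forall g g' i d i' d', 0 < g <= G -> 0 < g' <= G -> 0 < d -> 0 < d' ->
    g' * (r ^ i * (r ^ d).-1) = g * (s ^ i' * (s ^ d').-1) -> i + d < N.
Proof.
move=> r1 s1 ind.
have [p [q [pp pq det]]] := independent_logn r1 s1 ind.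
have [K1 K1P] := logn_pow_pred_le pp r1; have [K2 K2P] := logn_pow_pred_le pp s1.
have [K3 K3P] := logn_pow_pred_le pq r1; have [K4 K4P] := logn_pow_pred_le pq s1.
have [N1 near] := near_powers R G r1 s1.
pose K := K1 + K2 + K3 + K4 + G; pose H := r + s + G; pose c := 2 * H + 1.
pose A := logn p r + logn q r + logn p s + logn q s.
have [N0 N0P] := log_lt_linear (8 * (H * (1 + A * K))) (8 * (H * (A * 2))) c.
exists (c * (N0 + N1)).+1 => g g' i d i' d' gG g'G d0 d'0 e.
rewrite ltnNge; apply/negP => big.
have [/andP[g0 gG'] /andP[g'0 g'G']] := conj gG g'G.
have H2 k : k <= H -> k <= 2 ^ H by move=> kH; apply: leq_trans kH (ltnW (ltn_expl _ _)).
have rH : r <= 2 ^ H by apply: H2; rewrite /H; lia.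
have sH : s <= 2 ^ H by apply: H2; rewrite /H; lia.
have GH : G <= 2 ^ H by apply: H2; rewrite /H; lia.
have mm' := exponent_compare r1 s1 rH GH gG g'G d0 d'0 e.
have m'm := exponent_compare s1 r1 sH GH g'G gG d'0 d0 (esym e).
rewrite -/c in mm' m'm.
set m := i + d in mm' m'm big; set m' := i' + d' in mm' m'm.
pose n := minn m m'.
have cn : m <= c * n /\ m' <= c * n.
  have c1 : 0 < c by rewrite /c; lia.
  have m1 : m <= c * m by rewrite leq_pmull.
  have m2 : m' <= c * m' by rewrite leq_pmull.
  by rewrite /n; case: (leqP m m') => _; split.
have c1 : 0 < c by rewrite /c; lia.
have nN : N0 + N1 <= n.
  have : c * (N0 + N1) <= c * n by apply: leq_trans (proj1 cn); apply: ltnW.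
  by rewrite leq_pmul2l.
pose l := trunc_log 2 (c * n); pose E := K + 2 * l.
have dl : trunc_log 2 d <= l.
  by apply: leq_trunc_log; rewrite (leq_trans _ (proj1 cn))// leq_addl.
have d'l : trunc_log 2 d' <= l.
  by apply: leq_trunc_log; rewrite (leq_trans _ (proj2 cn))// leq_addl.
have pos a k : 1 < a -> 0 < k -> 0 < (a ^ k).-1.
  by move=> a1 k0; have := exp_gt1 a1 k0; lia.
have val t : prime t -> logn t g' + (i * logn t r + logn t (r ^ d).-1) =
    logn t g + (i' * logn t s + logn t (s ^ d').-1).
  move=> pt; have := congr1 (logn t) e.
  by rewrite !lognM ?muln_gt0 ?expn_gt0 ?pos// ?lognX ?(ltnW r1) ?(ltnW s1).
have lg t x : 0 < x <= G -> logn t x <= G.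
  by move=> /andP[x0 xG]; apply/ltnW/(leq_trans _ xG)/ltn_logl.
have [iE i'E] : i <= E * A /\ i' <= E * A.
  have v1 := val p pp; have v2 := val q pq.
  have x1 := K1P d d0; have x2 := K2P d' d'0; have x3 := K3P d d0; have x4 := K4P d' d'0.
  have y1 := lg p g gG; have y2 := lg p g' g'G; have y3 := lg q g gG; have y4 := lg q g' g'G.
  have [h1 h2] := @determinant_bound (logn p r) (logn p s) (logn q r) (logn q s) i i' E
    det ltac:(rewrite /E /K; lia) ltac:(rewrite /E /K; lia)
    ltac:(rewrite /E /K; lia) ltac:(rewrite /E /K; lia).
  by split; [apply: (leq_trans h1) | apply: (leq_trans h2)];
    rewrite leq_mul2l /A; apply/orP; right; lia.
have nl := N0P n (leq_trans (leq_addr _ _) nN).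
have log_small x : x <= E * A -> H + H * x <= n %/ 8.
  move=> xE; rewrite leq_divRL//; apply: leq_trans nl; rewrite -/l.
  rewrite (_ : 8 * _ + _ = (H + H * (E * A)) * 8); last by rewrite /E; ring.
  by rewrite leq_mul2r leq_add2l leq_mul2l xE orbT.
have tiny a b x y z : a <= 2 ^ H -> b <= 2 ^ H -> 1 < y -> x <= E * A -> n <= z ->
    a * b ^ x <= y ^ (z %/ 8).
  move=> aH bH y1 xE nz; apply: (@leq_trans (2 ^ (H + H * x))).
    by rewrite expnD expnM leq_mul// leq_expl.
  apply: (@leq_trans (2 ^ (z %/ 8))); last exact: leq_expl.
  by rewrite leq_exp2l// (leq_trans (log_small _ xE))// leq_div2r.
have gH : g <= 2 ^ H by apply: leq_trans GH.
have g'H : g' <= 2 ^ H by apply: leq_trans GH.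
have nm : n <= m by rewrite geq_minl.
have nm' : n <= m' by rewrite geq_minr.
have eS : g' * r ^ m + g * s ^ i' = g * s ^ m' + g' * r ^ i.
  rewrite /m /m' !expnD.
  have rd : r ^ d = (r ^ d).-1.+1 by rewrite prednK// expn_gt0 ltnW.
  have sd : s ^ d' = (s ^ d').-1.+1 by rewrite prednK// expn_gt0 ltnW.
  rewrite rd sd; move: e; move: (r ^ i) (s ^ i') (r ^ d).-1 (s ^ d').-1 => x y u v.
  by move=> e; rewrite !mulnSr !mulnDr; lia.
apply: (near g g' m m' gG g'G); try lia.
- move=> eq; have eq' : g' * r ^ i = g * s ^ i' by lia.
  apply: (ind d d' d0 d'0); move: eq; rewrite /m /m' !expnD !mulnA eq' => /eqP.
  by rewrite eqn_pmul2l ?muln_gt0 ?g0 ?expn_gt0 ?(ltnW s1)// => /eqP.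
- have := tiny g' r i s m' g'H rH s1 iE nm'; lia.
- have := tiny g s i' r m gH sH r1 i'E nm; lia.
Qed.

(** * Rational approximations given by the expansions *)

Local Open Scope ring_scope.

(** The value f m is the real number 0.x_m x_(m+1)... in base b, that is, the
    fractional part of b^m f 0. *)
Definition tails (R : realType) (b : nat) (x : word 'I_b) (f : nat -> R) : Prop :=
  forall m, 0 <= f m < 1 /\ f m.+1 = b%:R * f m - (x m)%:R.

(** The value 1 for f m would force all digits from m on to be b-1. *)
Lemma expansion_tails (R : realType) (b : nat) (xi : R) (x : word 'I_b) :
  (1 < b)%N -> is_expansion xi x ->
  exists2 f, f 0%N = xi - (Num.floor xi)%:~R & tails x f.
Proof.
move=> b1 [cv inf].
have b0 : 0 < b%:R :> R by rewrite ltr0n ltnW.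
pose S : nat -> R := series (fun k => (x k)%:R / b%:R ^+ k.+1 : R).
have SS m : S m.+1 = S m + (x m)%:R / b%:R ^+ m.+1.
  by rewrite /S /series /= big_nat_recr.
pose z := xi - (Num.floor xi)%:~R.
have cvS : (S n @[n --> \oo] --> z)%classic.
  rewrite /z (_ : S = fun n => ((Num.floor xi)%:~R + S n) - (Num.floor xi)%:~R); last first.
    by apply/funext => n; rewrite addrAC subrr add0r.
  exact: cvgB cv (cvg_cst _).
pose f m := b%:R ^+ m * (z - S m).
have fS m : f m.+1 = b%:R * f m - (x m)%:R.
  rewrite /f SS exprS; have := expf_neq0 m (lt0r_neq0 b0).
  have := lt0r_neq0 b0; move: ((b%:R : R) ^+ m) (b%:R : R) => u v v0 u0.
  by field; rewrite v0 u0.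
have Smono : {homo S : m n / (m <= n)%N >-> m <= n}.
  apply/nondecreasing_seqP => n; rewrite SS lerDl.
  by rewrite divr_ge0 ?exprn_ge0 ?ler0n.
have f_ge0 m : 0 <= f m.
  rewrite /f mulr_ge0 ?exprn_ge0 ?ler0n// subr_ge0.
  have := nondecreasing_cvgn_le Smono (cvgP _ cvS) m.
  by rewrite (cvg_lim _ cvS).
have Sup m n : S (m + n)%N <= S m + b%:R ^- m - b%:R ^- (m + n).
  elim: n => [|n IH]; first by rewrite addn0 addrK.
  rewrite addnS SS; apply: (@le_trans _ _ (S m + b%:R ^- m - b%:R ^- (m + n) +
      (x (m + n)%N)%:R / b%:R ^+ (m + n).+1)).
    by rewrite lerD2r.
  rewrite -!addrA lerD2l lerD2l exprS.
  have xb : (x (m + n)%N)%:R <= b%:R - 1 :> R.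
    by rewrite lerBrDr natr1 ler_nat.
  have u0 : 0 < b%:R ^+ (m + n) :> R by rewrite exprn_gt0.
  move: (b%:R ^+ (m + n)) u0 => u u0.
  rewrite -(ler_pM2r (mulr_gt0 b0 u0)) mulrDl mulfVK ?mulf_neq0 ?lt0r_neq0//.
  by rewrite !mulNr mulVf ?mulf_neq0 ?lt0r_neq0// mulrCA mulVf ?lt0r_neq0//; lra.
have f_le1 m : f m <= 1.
  rewrite /f -ler_pdivlMl ?exprn_gt0// mulr1 lerBlDl.
  apply: (cvgr_to_le cvS); near=> n.
  have /subnKC <- : (m <= n)%N by near: n; exact: nbhs_infty_ge.
  by apply: le_trans (Sup _ _) _; rewrite gerBl invr_ge0 exprn_ge0// ler0n.
exists f; first by rewrite /f expr0 mul1r /S /series /= big_geq// subr0.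
move=> m; split=> //; rewrite f_ge0 lt_neqAle f_le1 andbT /=.
apply/eqP => fm; case: inf.
have top k : f (m + k)%N = 1 /\ x (m + k)%N = b.-1 :> nat.
  have step n : f n = 1 -> f n.+1 = 1 /\ x n = b.-1 :> nat.
    move=> fn; have := fS n; rewrite fn mulr1 => e.
    have xb : (x n <= b.-1)%N by have := ltn_ord (x n); lia.
    have xbR : (x n)%:R <= b.-1%:R :> R by rewrite ler_nat.
    have bE : b%:R = b.-1%:R + 1 :> R by rewrite natr1 prednK// ltnW.
    have f1 := f_le1 n.+1; split; first by lra.
    by apply/eqP; rewrite eqn_leq xb -(@ler_nat R) /=; lra.
  elim: k => [|k [IH _]]; first by rewrite addn0; split=> //; case: (step _ fm).
  by have [h1 _] := step _ IH; rewrite addnS; split=> //; case: (step _ h1).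
apply: (sub_finite_set _ (finite_II m)) => k /= ne; rewrite ltnNge.
by apply/negP => /subnKC e; apply: ne; rewrite -e; case: (top (k - m)%N).
Unshelve. all: by end_near.
Qed.

Lemma tails_shift (R : realType) (b : nat) (x : word 'I_b) (f : nat -> R) (u v n : nat) :
  tails x f -> factor x u n = factor x v n ->
  f (u + n)%N - f (v + n)%N = b%:R ^+ n * (f u - f v).
Proof.
move=> tf; elim: n => [|n IH]; first by rewrite !addn0 expr0 mul1r.
move=> /factorS[/IH e ex]; rewrite !addnS.
by rewrite (tf (u + n)%N).2 (tf (v + n)%N).2 ex exprS -mulrA -e; ring.
Qed.

Lemma tails_close (R : realType) (b : nat) (x : word 'I_b) (f : nat -> R) (u v n : nat) :
  (1 < b)%N -> tails x f -> factor x u n = factor x v n ->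
  `|f u - f v| <= b%:R ^- n.
Proof.
move=> b1 tf e; have b0 : 0 < b%:R :> R by rewrite ltr0n ltnW.
have bn : 0 < b%:R ^+ n :> R by rewrite exprn_gt0.
rewrite -(ler_pM2l bn) mulfV ?lt0r_neq0//.
rewrite -{1}(ger0_norm (ltW bn)) -normrM -(tails_shift tf e) ler_norml.
have [/andP[h1 h2] _] := tf (u + n)%N; have [/andP[h3 h4] _] := tf (v + n)%N.
by apply/andP; split; lra.
Qed.

(** Different first letters could still give close tails A000 and (A-1)999; but a
    Sturmian word does not contain both the square of the digit 0 and the square of
    the digit b-1. *)
Lemma tails_apart (R : realType) (b : nat) (x : word 'I_b) (f : nat -> R) (u v : nat) :
  (1 < b)%N -> sturmian x -> tails x f -> x u <> x v ->
  b%:R ^- 3 <= `|f u - f v|.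
Proof.
move=> b1 st tf; have b0 : 0 < b%:R :> R by rewrite ltr0n ltnW.
wlog lt : u v / (x u < x v)%N => [hw ne|_].
  have [c|c|c] := ltngtP (x u) (x v); first exact: hw.
    by rewrite distrC; apply: hw => // /esym.
  by case: ne; apply/val_inj.
rewrite distrC; apply: le_trans (ler_norm _).
have b2 : 2 <= b%:R :> R by rewrite ler_nat.
have bE : b%:R = b.-1%:R + 1 :> R by rewrite natr1 prednK// ltnW.
set B := b%:R in b0 b2 bE *.
have dig k : 0 <= (x k)%:R <= B - 1.
  by rewrite ler0n bE addrK ler_nat /=; have := ltn_ord (x k); lia.
have fE k : f k = ((x k)%:R + f k.+1) / B.
  by rewrite (tf k).2 addrC subrK mulrC mulKf// lt0r_neq0.
have bnd k : 0 <= f k < 1 by case: (tf k).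
have ltR : (x u)%:R + 1 <= (x v)%:R :> R by rewrite natr1 ler_nat.
have gap : f u.+1 - f v.+1 <= 1 - B ^- 2.
  have Bi : 0 < B^-1 by rewrite invr_gt0.
  have B2 : B ^- 2 = B^-1 * B^-1 by rewrite -exprVn expr2.
  have B2p : 0 < B ^- 2 by rewrite B2 mulr_gt0.
  have BB : B^-1 * B = 1 by rewrite mulVf// lt0r_neq0.
  have Bi1 : B^-1 < 1 by rewrite invf_lt1//; lra.
  have B21 : B ^- 2 <= B^-1 by rewrite B2 ger_pMl// ltW.
  have high k : 1 - B^-1 < f k -> x k = b.-1 :> nat.
    rewrite fE ltr_pdivlMr// mulrBl mul1r BB => h.
    have [_ h4] := andP (bnd k.+1).
    apply/eqP; rewrite eqn_leq; apply/andP; split; first by have := ltn_ord (x k); lia.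
    by rewrite -ltnS -(@ltr_nat R) -natr1; lra.
  have low k : f k < B^-1 -> x k = 0%N :> nat.
    rewrite fE ltr_pdivrMr// BB => h; have [h3 _] := andP (bnd k.+1).
    by apply/eqP; rewrite -leqn0 -ltnS -(@ltr_nat R); lra.
  have [h1 h2] := andP (bnd u.+1); have [h3 h4] := andP (bnd v.+1).
  have [hu|hu] := leP (f u.+1) (1 - B ^- 2); first lra.
  have [hv|hv] := leP (B ^- 2) (f v.+1); first lra.
  have xu : x u.+1 = b.-1 :> nat by apply: high; lra.
  have xv : x v.+1 = 0%N :> nat by apply: low; lra.
  have xu2 : x u.+2 = b.-1 :> nat.
    apply: high; move: hu; rewrite fE xu ltr_pdivlMr// mulrBl mul1r B2 -mulrA BB mulr1 bE.
    by lra.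
  have xv2 : x v.+2 = 0%N :> nat.
    by apply: low; move: hv; rewrite fE xv add0r ltr_pdivrMr// B2 -mulrA BB mulr1.
  have : x u.+1 = x v.+1.
    by apply: (sturmian_square st); apply/val_inj; rewrite /= ?xu ?xv ?xu2 ?xv2.
  move/(congr1 (@nat_of_ord b)); rewrite xu xv => e.
  by have b0' := ltnW b1; move: b1; rewrite -(prednK b0') e.
rewrite (fE u) (fE v) -mulrBl (exprSr B 2) invfM ler_pM2r ?invr_gt0//.
by lra.
Qed.

Fixpoint prefix_value (b : nat) (x : word 'I_b) (m : nat) : nat :=
  if m is k.+1 then (b * prefix_value x k + x k)%N else 0%N.

Lemma tails_value (R : realType) (b : nat) (x : word 'I_b) (f : nat -> R) (m : nat) :
  tails x f -> f m = b%:R ^+ m * f 0%N - (prefix_value x m)%:R.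
Proof.
move=> tf; elim: m => [|m IH]; first by rewrite expr0 mul1r subr0.
by rewrite (tf m).2 IH /= natrD natrM exprS; ring.
Qed.

Lemma prefix_value_le (b : nat) (x : word 'I_b) (i j : nat) :
  (0 < b)%N -> (i <= j)%N -> (prefix_value x i <= prefix_value x j)%N.
Proof.
move=> b0 /subnKC <-; elim: (j - i)%N => [|k IH]; first by rewrite addn0.
rewrite addnS /= (leq_trans IH)// (leq_trans _ (leq_addr _ _))//.
by rewrite leq_pmull.
Qed.

(** A repetition at positions i < j approximates f 0 by the eventually periodic
    expansion of preperiod i and period j - i. *)
Lemma repetition_approx (R : realType) (b : nat) (x : word 'I_b) (f : nat -> R) (i j : nat) :
  (1 < b)%N -> (i < j)%N -> tails x f ->
  exists P : nat, (b ^ i * (b ^ (j - i)).-1)%:R * f 0%N - P%:R = f j - f i.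
Proof.
move=> b1 ij tf; have b0 := ltnW b1.
exists (prefix_value x j - prefix_value x i)%N.
rewrite natrB ?prefix_value_le 1?ltnW// (tails_value i tf) (tails_value j tf).
rewrite -subn1 mulnBr muln1 -expnD subnKC 1?ltnW// natrB ?natrX; first by ring.
by rewrite leq_exp2l// ltnW.
Qed.

Lemma repetition_denominator (b i j : nat) : (1 < b)%N -> (i < j)%N ->
  (b ^ j.-1 <= b ^ i * (b ^ (j - i)).-1 < b ^ j)%N.
Proof.
move=> b1 ij; have b0 := ltnW b1.
have -> : j.-1 = (i + (j - i).-1)%N by lia.
have -> : (b ^ j = b ^ i * b ^ (j - i))%N by rewrite -expnD subnKC// ltnW.
rewrite expnD leq_pmul2l ?ltn_pmul2l ?expn_gt0 ?b0//.
have : (b ^ (j - i).-1 < b ^ (j - i))%N by rewrite ltn_exp2l//; lia.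
by move: (b ^ (j - i).-1)%N (b ^ (j - i))%N => u v; lia.
Qed.

Lemma nat_close (R : realType) (a b : nat) : `|a%:R - b%:R : R| < 1 -> a = b.
Proof.
rewrite ltr_norml => /andP[h1 h2]; apply/eqP; rewrite eqn_leq; apply/andP; split.
  by rewrite -ltnS -(@ltr_nat R) -natr1; lra.
by rewrite -ltnS -(@ltr_nat R) -natr1; lra.
Qed.

Lemma cross_difference (R : realType) (z d1 d2 : R) (P1 Q1 P2 Q2 : nat) :
  Q1%:R * z - P1%:R = d1 -> Q2%:R * z - P2%:R = d2 ->
  (P1 * Q2)%:R - (P2 * Q1)%:R = Q1%:R * d2 - Q2%:R * d1.
Proof. by move=> <- <-; rewrite !natrM; ring. Qed.

Lemma mul_inv_lt (R : realType) (k a c : nat) (X : R) : (k * a < c)%N ->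
  `|X| <= c%:R^-1 -> k%:R * (a%:R * `|X|) < 1.
Proof.
move=> lt le; have c0 : 0 < c%:R :> R by rewrite ltr0n; apply: leq_ltn_trans lt.
rewrite mulrA -natrM; apply: (@le_lt_trans _ _ ((k * a)%:R * c%:R^-1)).
  by rewrite ler_wpM2l.
by rewrite ltr_pdivrMr// mul1r ltr_nat.
Qed.

(** A long plateau of the first word gives an approximation P/Q of f 0 which is so
    good that it coincides with an approximation P'/Q' given by the second word.
    The next plateau shows that P/Q is almost in lowest terms. *)
Lemma common_approximation (R : realType) (r s : nat) (x : word 'I_r) (y : word 'I_s)
    (f h : nat -> R) : (1 < r)%N -> (1 < s)%N ->
  sturmian x -> sturmian y -> tails x f -> tails y h -> f 0%N = h 0%N ->
  exists G, forall N, exists g g' i d i' d',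
    [/\ (0 < g <= G)%N, (0 < g' <= G)%N, (0 < d)%N, (0 < d')%N &
      (N <= i + d)%N /\
      (g' * (r ^ i * (r ^ d).-1) = g * (s ^ i' * (s ^ d').-1))%N].
Proof.
move=> r1 s1 sx sy tf th fh; set z := f 0%N in fh.
have r0 := ltnW r1; have s0 := ltnW s1.
have [C [C3 rC]] : exists C, (3 <= C)%N /\ (4 * s ^ 2 <= r ^ C.-1)%N.
  (* C leaves room for the level of the second word to be rounded down by one digit
     of base s, and forces the next plateau to give another fraction. *)
  exists (4 * s ^ 2 + 3)%N; split; first by rewrite leq_addl.
  by rewrite (leq_trans _ (ltnW (ltn_expl _ r1)))// addnS leq_addr.
exists ((r ^ 2 + 1) * r ^ C)%N => N.
have [m [i [n [Nm mn pl]]]] := long_plateau C N sx.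
have [/andP[im _] _ en nen] := pl.
have [i1 [n1 pl1]] := plateau_next sx pl.
have [/andP[i1n n1n] _ en1 _] := pl1.
have n14 : (3 + m.+1 <= n1)%N by lia.
have mC : (m + C = m.+1 + C.-1)%N by lia.
have ij : (i < m.+1)%N by lia.
have ij1 : (i1 < n.+2)%N by lia.
have [P PE] := repetition_approx r1 ij tf.
have [P1 P1E] := repetition_approx r1 ij1 tf.
have /andP[Qlo Qhi] := repetition_denominator r1 ij.
have /andP[Q1lo Q1hi] := repetition_denominator r1 ij1.
have up := tails_close r1 tf en; have up1 := tails_close r1 tf en1.
have low := tails_apart r1 sx tf nen.
rewrite (tails_shift tf en) in low.
rewrite normrM normrX normr_nat distrC in low.
rewrite distrC in up; rewrite distrC in up1.
(* The largest level n' with 2 s^(n'+1) <= r^(m+C): the second word is cut at the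
   precision of level m + C of the first one. *)
have [n' lo' hi'] : exists2 n', (2 * s ^ n'.+1 <= r ^ (m + C))%N &
    (r ^ (m + C) < 2 * s ^ n'.+2)%N.
  have ub k : (2 * s ^ k.+1 <= r ^ (m + C))%N -> (k <= r ^ (m + C))%N.
    move=> le; apply: leq_trans le; have := ltn_expl k.+1 s1; lia.
  have ex : exists k, (2 * s ^ k.+1 <= r ^ (m + C))%N.
    exists 0%N; rewrite expn1; apply: (@leq_trans (r ^ C.-1)).
      by apply: leq_trans rC; rewrite expnS expn1; nia.
    by rewrite leq_exp2l//; lia.
  case: (ex_maxnP ex ub) => k le mx; exists k => //.
  by rewrite ltnNge; apply/negP => /mx; rewrite ltnn.
have [i' [j' [ij' j'n e' _]]] := first_repetition n' sy.
have [P' P'E] := repetition_approx s1 ij' th.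
have /andP[Q'lo Q'hi] := repetition_denominator s1 ij'.
have up' := tails_close s1 th e'; rewrite distrC in up'.
rewrite -fh -/z in P'E; rewrite -/z in PE P1E.
set Q := (r ^ i * _)%N in PE Qlo Qhi; set Q1 := (r ^ i1 * _)%N in P1E Q1lo Q1hi.
set Q' := (s ^ i' * _)%N in P'E Q'lo Q'hi.
move: PE P1E P'E up up1 up' low; move: (f m.+1 - f i) (f n.+2 - f i1) (h j' - h i').
move=> D D1 D' PE P1E P'E up up1 up' low.
have rp k : (0 < r ^ k)%N by rewrite expn_gt0 r0.
have rR : 0 < r%:R :> R by rewrite ltr0n.
rewrite -natrX in up; rewrite -natrX in up1; rewrite -natrX in up'.
have small1 : r%:R ^+ 3 * (Q%:R * `|D1|) < 1.
  rewrite -natrX; apply: (mul_inv_lt _ up1).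
  apply: (@leq_trans (r ^ 3 * r ^ m.+1)); first by rewrite ltn_pmul2l.
  by rewrite -expnD leq_exp2l.
have large : 1 <= r%:R ^+ 2 * (Q1%:R * `|D|).
  have e3 : r%:R ^+ 3 * (r%:R ^+ n * `|D|) <= r%:R ^+ 2 * (Q1%:R * `|D|).
    rewrite !mulrA ler_wpM2r// -exprD -natrX -natrX -natrM ler_nat.
    by apply: leq_trans (leq_mul (leqnn _) Q1lo); rewrite -expnD leq_exp2l//; lia.
  apply: le_trans e3; rewrite -ler_pdivrMl ?exprn_gt0// mulr1; exact: low.
have bounded : Q1%:R * `|D| <= (r ^ 2)%:R.
  apply: (@le_trans _ _ ((r ^ n.+2)%:R * (r ^ n)%:R^-1)).
    by apply: ler_pM => //; rewrite ler_nat ltnW.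
  rewrite ler_pdivrMr ?ltr0n// -natrM ler_nat -expnD leq_exp2l//; lia.
have cross := cross_difference PE P1E.
have r3 : 1 <= r%:R ^+ 3 :> R by rewrite -natrX ler1n.
have r23 : r%:R ^+ 2 <= r%:R ^+ 3 :> R by rewrite -!natrX ler_nat leq_exp2l.
have q1 : 0 <= Q%:R * `|D1| by rewrite mulr_ge0.
have small1' : Q%:R * `|D1| <= 1.
  by apply: le_trans (ltW small1); rewrite ler_peMl.
have distinct : (P * Q1)%N <> (P1 * Q)%N.
  move=> e; move: cross; rewrite e subrr => /esym/eqP; rewrite subr_eq0 => /eqP e2.
  have : Q%:R * `|D1| = Q1%:R * `|D|.
    by rewrite -[Q%:R]normr_nat -[Q1%:R]normr_nat -!normrM e2.
  move=> e4; move: large; rewrite -e4 => large.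
  have : r%:R ^+ 2 * (Q%:R * `|D1|) < 1 by apply: le_lt_trans small1; rewrite ler_wpM2r.
  by rewrite ltNge large.
pose g := gcdn P Q.
have Q0 : (0 < Q)%N by apply: leq_trans Qlo.
have g0 : (0 < g)%N by rewrite gcdn_gt0 Q0 orbT.
have gr : (g <= r ^ 2 + 1)%N.
  have gP : (g %| P * Q1)%N by rewrite dvdn_mulr// dvdn_gcdl.
  have gQ : (g %| P1 * Q)%N by rewrite dvdn_mull// dvdn_gcdr.
  have le : g%:R <= `|(P * Q1)%:R - (P1 * Q)%:R| :> R.
    have [lt|lt|//] := ltngtP (P * Q1)%N (P1 * Q)%N.
      rewrite distrC -natrB 1?ltnW// normr_nat ler_nat dvdn_leq ?subn_gt0//.
      exact: dvdn_sub.
    rewrite -natrB 1?ltnW// normr_nat ler_nat dvdn_leq ?subn_gt0//.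
    exact: dvdn_sub.
  rewrite -(@ler_nat R); apply: (le_trans le); rewrite cross natrD.
  apply: (le_trans (ler_normB _ _)); rewrite !normrM !normr_nat addrC.
  exact: lerD.
have Qs : (2 * Q < s ^ n')%N.
  apply: (@leq_ltn_trans (2 * r ^ m.+1)); first by rewrite leq_mul2l ltnW.
  have s20 : (0 < 2 * s ^ 2)%N by rewrite muln_gt0 expn_gt0 s0.
  rewrite -(ltn_pmul2l s20).
  apply: (@leq_ltn_trans (r ^ (m + C))).
    rewrite mC expnD (_ : 2 * s ^ 2 * (2 * _) = r ^ m.+1 * (4 * s ^ 2))%N; last by ring.
    by rewrite leq_mul2l rC orbT.
  by apply: leq_trans hi' _; rewrite -mulnA -expnD.
have Q'r : (2 * Q' < r ^ n)%N.
  apply: (@leq_trans (2 * s ^ n'.+1)).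
    by rewrite ltn_pmul2l// (leq_trans Q'hi)// leq_exp2l.
  by apply: leq_trans lo' _; rewrite leq_exp2l.
have same : (P * Q')%N = (P' * Q)%N.
  apply: (@nat_close R); rewrite (cross_difference PE P'E).
  apply: (le_lt_trans (ler_normB _ _)); rewrite !normrM !normr_nat.
  have := mul_inv_lt Qs up'; have := mul_inv_lt Q'r up.
  by move: (_ * `|D|) (_ * `|D'|) => u v; lra.
have gQ : (Q = g * (Q %/ g))%N by rewrite mulnC divnK// dvdn_gcdr.
have gP : (P = g * (P %/ g))%N by rewrite mulnC divnK// dvdn_gcdl.
have qQ' : (Q %/ g %| Q')%N.
  have co : coprime (Q %/ g) (P %/ g).
    rewrite /coprime -(eqn_pmul2l g0) muln_gcdr -gQ -gP muln1 gcdnC.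
    by [].
  rewrite -(Gauss_dvdr _ co); apply/dvdnP; exists P'.
  by apply/eqP; rewrite -(eqn_pmul2l g0) mulnA -gP same mulnCA -gQ.
pose g' := (Q' %/ (Q %/ g))%N.
have gE : (g' * Q = g * Q')%N by rewrite {1}gQ mulnCA /g' divnK.
have Q'0 : (0 < Q')%N by apply: leq_trans Q'lo; rewrite expn_gt0 s0.
have g'0 : (0 < g')%N.
  by rewrite divn_gt0 ?(dvdn_gt0 Q'0)// dvdn_leq.
exists g, g', i, (m.+1 - i)%N, i', (j' - i')%N; split.
- by rewrite g0 (leq_trans gr)// leq_pmulr.
- rewrite g'0 -(leq_pmul2r (rp m)); apply: (@leq_trans (g' * Q)).
    by rewrite leq_mul2l Qlo orbT.
  rewrite gE -mulnA leq_mul// -expnD addnC (leq_trans _ lo')// .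
  rewrite (leq_trans (ltnW Q'hi))// (@leq_trans (s ^ n'.+1))// ?leq_pmull//.
  by rewrite leq_exp2l.
- by rewrite subn_gt0.
- by rewrite subn_gt0.
- by split=> //; rewrite subnKC 1?ltnW// (leq_trans Nm)// ltnW.
Qed.

(** * Conclusion *)

Local Close Scope ring_scope.

(** With u, v coprime and x u = y v + 1, the root t is s^x / r^y. *)
Lemma common_base (r s u v : nat) : 1 < r -> 1 < s -> 0 < u -> 0 < v ->
  r ^ u = s ^ v ->
  exists t a b, [/\ 1 < t, 0 < a, 0 < b, coprime a b & r = t ^ a /\ s = t ^ b].
Proof.
move=> r1 s1 u0 v0 e; pose g := gcdn u v.
have g0 : 0 < g by rewrite gcdn_gt0 u0.
have [u1 uE] := dvdnP (dvdn_gcdl u v); have [v1 vE] := dvdnP (dvdn_gcdr u v).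
rewrite -/g in uE vE.
have u10 : 0 < u1 by move: u0; rewrite uE muln_gt0 => /andP[].
have v10 : 0 < v1 by move: v0; rewrite vE muln_gt0 => /andP[].
have co : coprime u1 v1.
  by rewrite /coprime -(eqn_pmul2r g0) muln_gcdl -uE -vE mul1n.
have e1 : r ^ u1 = s ^ v1.
  by apply/eqP; rewrite -(eqn_exp2r _ _ g0) -!expnM -uE -vE e.
have [x y xy _] := egcdnP v1 u10; rewrite (eqP co) in xy.
have rs : (r ^ y) ^ u1 = s ^ (y * v1) by rewrite -expnM mulnC expnM e1 -expnM mulnC.
have dv : r ^ y %| s ^ x.
  by rewrite -(dvdn_pexp2r _ _ u10) rs -expnM xy expnD dvdn_mulr.
have [t tE] := dvdnP dv.
have ts : t ^ u1 = s.
  have := congr1 (expn^~ u1) tE; rewrite expnMn rs -expnM xy expnD expn1 mulnC => /eqP.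
  by rewrite eqn_pmul2r ?expn_gt0 ?(ltnW s1)// => /eqP.
have tr : t ^ v1 = r.
  by apply/eqP; rewrite -(eqn_exp2r _ _ u10) e1 -expnM mulnC expnM ts.
exists t, v1, u1; split=> //; last by rewrite coprime_sym.
by case: t ts {tE tr} => [|[|//]] ts; move: s1; rewrite -ts ?exp1n ?exp0n.
Qed.

Local Open Scope ring_scope.

Lemma truncn_expands (R : realType) (t : nat) (z : R) : (0 < t)%N -> 0 <= z ->
  expands t (fun m => Num.truncn (t%:R ^+ m * z)).
Proof.
move=> t0 z0; split=> // m; apply/esym.
have t0R : 0 < t%:R :> R by rewrite ltr0n.
have p0 k : 0 <= t%:R ^+ k * z by rewrite mulr_ge0// exprn_ge0// ltW.
have /andP[h1 h2] := truncn_itv (p0 m.+1).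
rewrite exprS -mulrA in h1 h2 *.
set n := Num.truncn _ in h1 h2 *.
apply/esym/truncn_def; apply/andP; split.
  rewrite -(ler_pM2l t0R); apply: le_trans h1.
  by rewrite -natrM ler_nat mulnC leq_trunc_div.
rewrite -(ltr_pM2l t0R); apply: lt_le_trans h2 _.
by rewrite -natrM ler_nat mulnC ltn_ceil.
Qed.

Lemma tails_window (R : realType) (b t a : nat) (x : word 'I_b) (f : nat -> R) :
  b = (t ^ a)%N -> tails x f ->
  forall k, x k = window t (fun m => Num.truncn (t%:R ^+ m * f 0%N)) (a * k) a :> nat.
Proof.
move=> bE tf k; have bR : b%:R = t%:R ^+ a :> R by rewrite bE natrX.
have val n : Num.truncn (t%:R ^+ (a * n) * f 0%N) = prefix_value x n.
  apply: truncn_def; have [/andP[h1 h2] _] := tf n.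
  move: h1 h2; rewrite (tails_value n tf) bR -exprM -natr1.
  by move=> h1 h2; apply/andP; split; lra.
rewrite /window -mulnSr val /= -bE mulnC modnMDl modn_small//.
Qed.

Theorem corollary1p6 (R : realType) (r s : nat)
    (hr : (2 <= r)%N) (hs : (2 <= s)%N) (hrs : r <> s) :
  ~ exists xi : R, has_sturmian_expansion r xi /\ has_sturmian_expansion s xi.
Proof.
move=> [xi [[x [ex sx]] [y [ey sy]]]].
have [f f0 tf] := expansion_tails hr ex; have [h h0 th] := expansion_tails hs ey.
have fh : f 0%N = h 0%N by rewrite f0 h0.
have [ind|dep] := pselect (multiplicatively_independent r s).
  have [G GP] := common_approximation hr hs sx sy tf th fh.
  have [N NP] := sunit_equation R G hr hs ind.
  have [g [g' [i [d [i' [d' [gG g'G d0 d'0 [le e]]]]]]]] := GP N.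
  by have := NP _ _ _ _ _ _ gG g'G d0 d'0 e; rewrite ltnNge le.
have [u [v [u0 v0 e]]] : exists u v, [/\ (0 < u)%N, (0 < v)%N & (r ^ u = s ^ v)%N].
  apply: contrapT => no; apply: dep => u v u0 v0 e; apply: no.
  by exists u, v.
have [t [a [b [t1 a0 b0 co [rE sE]]]]] := common_base hr hs u0 v0 e.
have z0 : 0 <= f 0%N by have [/andP[]] := tf 0%N.
have exT := truncn_expands (ltnW t1) z0.
have xW := tails_window rE tf; have yW := tails_window sE th; rewrite -fh in yW.
have b1 := common_base_exponent t1 a0 b0 co exT xW yW sx sy.
rewrite coprime_sym in co.
have a1 := common_base_exponent t1 b0 a0 co exT yW xW sy sx.
by apply: hrs; rewrite rE sE a1 b1.
Qed.
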